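(* Suppose $w$ has polynomial growth, $\phi,\psi\in BUC_w(\mathbf R,X)$, there is a closed subspace $Y$ of $L(X)$ containing all the resolvent operators of $A$ such that $C\circ\xi\in\mathcal F$ whenever $\xi\in\mathcal F$ and $C\in Y$, and $B\phi=A\circ\phi+\psi$. If $\psi|_J\in\mathcal F$, then $\theta_B(sp_{\mathcal F}(\phi))\subseteq\sigma(A)\cap p_B(\mathbf R)$.
   Context: $X$ is a complex Banach space and $L(X)$ the space of bounded linear operators on it; $J\in\{\mathbf R,\mathbf R_+\}$. $A$ is a closed, densely defined linear operator on $X$ with domain $D(A)$ and non-empty resolvent set; $\sigma(A)$ is its spectrum. $B=\sum_{j=0}^mb_j(d/dt)^j$ with $b_j\in\mathbf C$, $b_m\ne0$, with domain $D(B)=BUC_w(\mathbf R,X)\cap C^m(\mathbf R,X)$. $p_B(s)=\sum_{j=0}^mb_j(is)^j$ for $s\in\mathbf R$. Characters of $\mathbf R$ are $\gamma_s(t)=e^{ist}$, $s\in\mathbf R$, and $\theta_B(\gamma_s)=p_B(s)$. The equation $B\phi=A\circ\phi+\psi$ means $\phi\in D(B)$, $\phi(\mathbf R)\subseteq D(A)$ and $(B\phi)(t)=A\phi(t)+\psi(t)$ for all $t\in\mathbf R$. $\phi_h(t)=\phi(t+h)$, $\Delta_h\phi=\phi_h-\phi$. The weight $w:\mathbf R\to\mathbf R$ is a continuous function with $w\ge 1$, $w(s+t)\le w(s)w(t)$, $w(-t)=w(t)$, $\sum_{n\ge1}n^{-2}\log w(nt)<\infty$ for all $s,t$; $w=1$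 or $1/w\in C_0(\mathbf R)$; $\Delta_hw/w\in C_0(\mathbf R)$ for every $h$; and $\sup_t|\Delta_hw(t)|/w(t)\to0$ as $h\to0$. (A bounded weight is assumed to be $1$.) It has polynomial growth of order $N\in\mathbf Z_+$ if $\lim_{|m|\to\infty}w(mt)/(1+|m|^{N+1})=0$ for all $t\in\mathbf R$ and $\inf_{m\in\mathbf Z}w(mt)/|m|^N>0$ for some $t$; it has polynomial growth if this holds for some $N$. $BUC_w(J,X)$ is the Banach space of continuous $\phi:J\to X$ with $\|\phi\|_{w,\infty}=\sup_{t\in J}\|\phi(t)\|/w(t)<\infty$ and $\|\Delta_h\phi\|_{w,\infty}\to0$ as $h\to0$ in $J$. $\mathcal F$ is a translation invariant closed subspace of $BUC_w(J,X)$ such that: if $\phi\in BUC_w(\mathbf R,X)$ and $\phi|_J\in\mathcal F$ then $\phi_t|_J\in\mathcal F$ for all $t\in\mathbf R$. $L^1_w(\mathbf R)$ is the space of measurable $f:\mathbf R\to\mathbf C$ with $\int|f|w<\infty$; $\widehat f(\gamma)=\int\gamma(-t)f(t)\,dt$; $\phi*f(t)=\int\phi(t-s)f(s)\,ds$. $sp_{\mathcal F}(\phi)=\{\gamma\in\widehat{\mathbf R}:\widehat f(\gamma)=0$ for all $f\in L^1_w(\mathbf R)$ with $(\phi*f)|_J\in\mathcal F\}$. *)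

(* Defs.v *)
From HB Require Import structures.
From mathcomp Require Import all_boot all_order all_algebra.
From mathcomp Require Import complex.
From mathcomp Require Import all_classical all_reals all_analysis.

Set Implicit Arguments.
Unset Strict Implicit.
Unset Printing Implicit Defensive.
Import Order.TTheory GRing.Theory Num.Theory.
Import numFieldNormedType.Exports.

Local Open Scope classical_set_scope.
Local Open Scope ring_scope.
Local Open Scope complex_scope.

(* Norms of spaces over R[i] take values in R[i]; they are nonnegative
   reals there, so taking the real part only changes the type. *)
Definition rnorm (R : realType) (V : normedZmodType R[i]) (v : V) : R :=
  complex.Re `|v|.

Section Weights.
Variables (R : realType) (w : R -> R).

Definition C0 (g : R -> R) : Prop :=
  [/\ continuous g, g x @[x --> +oo] --> 0 & g x @[x --> -oo] --> 0].

(* The convention that a bounded weight is 1 is implied by [weight_infty]. *)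
Record is_weight : Prop := IsWeight {
  weight_continuous : continuous w;
  weight_ge1 : forall t, 1 <= w t;
  weight_submul : forall s t, w (s + t) <= w s * w t;
  weight_even : forall t, w (- t) = w t;
  weight_log : forall t,
    (\sum_(1 <= n <oo) (n%:R ^- 2 * ln (w (n%:R * t)))%:E < +oo)%E;
  weight_infty : w = cst 1 \/ C0 (fun t => (w t)^-1);
  weight_diff_C0 : forall h, C0 (fun t => (w (t + h) - w t) / w t);
  weight_diff_cvg0 :
    ereal_sup [set (`|w (t + h) - w t| / w t)%:E | t in [set: R]]
      @[h --> (0 : R)] --> 0%E
}.

(* The quotient by |m|^N is +oo at m = 0 when N > 0, hence the restriction to
   m != 0 in the infimum (for N = 0 the omitted term is w 0 >= 1). *)
Definition polynomial_growth_order (N : nat) : Prop :=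
  (forall t e : R, 0 < e -> exists M : nat, forall m : int, (M <= `|m|)%N ->
     `|w (m%:~R * t) / (1 + `|m%:~R| ^+ N.+1)| < e) /\
  (exists t : R,
     (0 < ereal_inf [set (w (m%:~R * t) / `|m%:~R| ^+ N)%:E
                    | m in [set m : int | (m != 0)%R]])%E).

Definition polynomial_growth : Prop := exists N, polynomial_growth_order N.

End Weights.

Section BUC.
Variables (R : realType) (X : completeNormedModType R[i]).
Variables (w : R -> R) (J : set R).

Definition shift (h : R) (phi : R -> X) : R -> X := fun t => phi (t + h).

(* A function J -> X is represented by any extension of it to R; the norm, and
   the membership predicate [BUCw], only see values on J. *)
Definition wnorm (phi : R -> X) : \bar R :=
  ereal_sup [set (rnorm (phi t) / w t)%:E | t in J].

Definition BUCw : set (R -> X) := [set phi |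
  [/\ {within J, continuous phi}, (wnorm phi < +oo)%E &
      wnorm (shift h phi \- phi) @[h --> within J (nbhs (0 : R))] --> 0%E]].

End BUC.

Section Spaces.
Variables (R : realType) (X : completeNormedModType R[i]).

(* Since F is closed for the seminorm "sup over J", it contains with xi every
   function of BUCw w J that agrees with xi on J: such F are exactly the sets
   of all extensions of the members of a closed subspace of BUC_w(J, X), and
   "F phi" means that the restriction of phi to J belongs to that subspace. *)
Record admissible (w : R -> R) (J : set R) (F : set (R -> X)) : Prop :=
  Admissible {
  adm_sub : F `<=` BUCw w J;
  adm_0 : F (cst 0);
  adm_linear : forall (a : R[i]) xi eta, F xi -> F eta ->
    F (fun t => a *: xi t + eta t);
  adm_closed : forall xi, BUCw w J xi ->
    (forall e : R, 0 < e ->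
       exists2 eta, F eta & (wnorm w J (xi \- eta)%R < e%:E)%E) -> F xi;
  adm_translation : forall h xi, J h -> F xi -> F (shift h xi);
  adm_extension : forall phi, BUCw w setT phi -> F phi ->
    forall t, F (shift t phi)
}.

Definition opnorm (T : X -> X) : \bar R :=
  ereal_sup [set (rnorm (T x))%:E | x in [set x | rnorm x <= 1]].

Definition bounded_op : set (X -> X) :=
  [set T | linear T /\ (opnorm T < +oo)%E].

Record closed_op_subspace (Y : set (X -> X)) : Prop := ClosedOpSubspace {
  cos_sub : Y `<=` bounded_op;
  cos_0 : Y (cst 0);
  cos_linear : forall (a : R[i]) S T, Y S -> Y T ->
    Y (fun x => a *: S x + T x);
  cos_closed : forall T, bounded_op T ->
    (forall e : R, 0 < e -> exists2 S, Y S & (opnorm (T \- S)%R < e%:E)%E) -> Y T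
}.

(* An unbounded operator is a domain D together with a function A, of which
   only the values on D are meaningful. *)
Record closed_dd_operator (D : set X) (A : X -> X) : Prop := ClosedDDOperator {
  dom_0 : D 0;
  dom_linear : forall (a : R[i]) x y, D x -> D y -> D (a *: x + y);
  op_linear : forall (a : R[i]) x y, D x -> D y ->
    A (a *: x + y) = a *: A x + A y;
  op_dense : dense D;
  op_closed : closed [set p : X * X | D p.1 /\ p.2 = A p.1]
}.

Definition is_resolvent (D : set X) (A : X -> X) (lambda : R[i])
    (S : X -> X) : Prop :=
  [/\ bounded_op S,
      forall x, D (S x) /\ lambda *: S x - A (S x) = x &
      forall x, D x -> S (lambda *: x - A x) = x].

Definition resolvent_set (D : set X) (A : X -> X) : set R[i] :=
  [set lambda | exists S, is_resolvent D A lambda S].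

Definition spectrum (D : set X) (A : X -> X) : set R[i] :=
  ~` resolvent_set D A.

End Spaces.

Section Differential.
Variables (R : realType) (X : completeNormedModType R[i]).

(* Derivatives with respect to a real variable: X is a module over R[i] only,
   so the library's [derive1] does not apply. *)
Definition diff_quotient (phi : R -> X) (t : R) : R -> X :=
  fun h => (h^-1)%:C *: (phi (t + h) - phi t).

Definition rderivable (phi : R -> X) (t : R) : Prop :=
  cvg (diff_quotient phi t h @[h --> (0 : R)^']).

Definition rderive (phi : R -> X) : R -> X :=
  fun t => lim (diff_quotient phi t h @[h --> (0 : R)^']).

Definition rderiven (j : nat) (phi : R -> X) : R -> X := iter j rderive phi.

Definition Cm (m : nat) : set (R -> X) := [set phi |
  (forall j, (j < m)%N -> forall t, rderivable (rderiven j phi) t) /\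
  continuous (rderiven m phi)].

Variables (m : nat) (b : 'I_m.+1 -> R[i]).

Definition dom_B (w : R -> R) : set (R -> X) := BUCw w setT `&` Cm m.

Definition op_B (phi : R -> X) : R -> X :=
  fun t => \sum_(j < m.+1) b j *: rderiven j phi t.

Definition p_B (s : R) : R[i] := \sum_(j < m.+1) b j * ('i%C * s%:C) ^+ j.

End Differential.

Section Bochner.
Variables (R : realType) (V : normedModType R[i]).
Let mu := @lebesgue_measure R.

Definition simple_with_integral (s : R -> V) (v : V) : Prop :=
  exists n (E : 'I_n -> set R) (x : 'I_n -> V),
  [/\ forall i, measurable (E i) /\ (mu (E i) < +oo)%E,
      forall t, s t = \sum_(i < n) (\1_(E i) t)%:C *: x i &
      v = \sum_(i < n) (fine (mu (E i)))%:C *: x i].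

(* Measurability is with respect to the Borel sets, and strong measurability
   is convergence everywhere of simple functions; every function that is
   Bochner integrable in the a.e. sense is a.e. equal to one of these. *)
Definition is_bochner_integral (g : R -> V) (v : V) : Prop :=
  exists (s : nat -> R -> V) (I : nat -> V),
  [/\ forall n, simple_with_integral (s n) (I n),
      forall t, s n t @[n --> \oo] --> g t,
      (\int[mu]_t (rnorm (g t - s n t))%:E)%E @[n --> \oo] --> 0%E &
      I n @[n --> \oo] --> v].

(* The value is 0 by convention when g is not Bochner integrable. *)
Definition bochner_integral (g : R -> V) : V :=
  xget 0 [set v | is_bochner_integral g v].

End Bochner.

Section Spectrum.
Variable (R : realType).

Definition character (s : R) : R -> R[i] :=
  fun t => cos (s * t) +i* sin (s * t).

Definition L1w (w : R -> R) : set (R -> R[i]) := [set f |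
  [/\ measurable_fun setT (fun t => complex.Re (f t)),
      measurable_fun setT (fun t => complex.Im (f t)) &
      (\int[@lebesgue_measure R]_t (rnorm (f t) * w t)%:E < +oo)%E]].

Definition complex_integral (g : R -> R[i]) : R[i] :=
  (\int[@lebesgue_measure R]_t complex.Re (g t))%R +i*
  (\int[@lebesgue_measure R]_t complex.Im (g t))%R.

Definition fourier (f : R -> R[i]) (gamma : R -> R[i]) : R[i] :=
  complex_integral (fun t => gamma (- t) * f t).

Variable X : completeNormedModType R[i].

Definition convolution (phi : R -> X) (f : R -> R[i]) : R -> X :=
  fun t => bochner_integral (fun s => f s *: phi (t - s)).

(* The dual group is parametrised by R through the bijection [character], so
   that theta_B becomes p_B. *)
Definition sp (w : R -> R) (F : set (R -> X)) (phi : R -> X) : set R :=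
  [set s | forall f, L1w w f -> F (convolution phi f) ->
    fourier f (character s) = 0].

End Spectrum.

(* Main.v *)
Require Import Defs.
From HB Require Import structures.
From mathcomp Require Import all_boot all_order all_algebra.
From mathcomp Require Import complex.
From mathcomp Require Import all_classical all_reals all_analysis.
From mathcomp Require Import measurable_realfun ring lra.
Import Order.TTheory GRing.Theory Num.Theory.
Import numFieldNormedType.Exports.
Local Open Scope classical_set_scope.
Local Open Scope ring_scope.
Local Open Scope complex_scope.
Set Implicit Arguments.
Unset Strict Implicit.
Unset Printing Implicit Defensive.

(* If [lambda = p_B(s0)] is in the resolvent set, with resolvent [T], the equation
   reads [phi = T psi - T (B - lambda) phi]. Convolving with [f = gamma_s0 g], where
   [g] is band-limited to frequencies at most [d], and moving [B - lambda] onto [f]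
   gives [phi * f = T (psi * f) - T (phi * f')] with [f' = gamma_s0 Q(d/dt) g] and
   [Q(x) = p_B(s0 - i x) - lambda], so [Q(0) = 0]. Iterating, [phi * f] is a sum of
   the terms [(-1)^k T^(k+1) (psi * f_k)], which lie in [F] because convolutions
   [psi * f_k] are limits of combinations of translates of [psi], up to a remainder
   of order [(||T|| q(d))^n], where [q(d)] tends to 0 with [d]. For small [d] hence
   [phi * f] is in [F], while the Fourier transform of [f] at [gamma_s0] is the
   integral of [g], which is nonzero for [g] an even power of the sinc function; so
   [s0] is not in the spectrum. Polynomial growth of [w] makes such a [g], with all
   its derivatives, integrable against [w]. *)

(** * Norms and derivatives over the complex scalars *)

(** Two obstacles shape the argument. First, the remainder must be small in the weighted norm, so
    [Q(d/dt)] has to shrink kernels quantitatively. The kernels are therefore taken in a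
    Bernstein-type class: [|g^(k)| <= A H d^k] for all [k], with one fixed majorant [H].
    Constant-coefficient operators keep [H] and [d] and change only [A]. With [c = i s0], the
    operator [(d/dt + c)^j - c^j] costs the factor [(d + |c|)^j - |c|^j], which is linear in [d]
    near 0; weighted by the [|b_j|], these factors add up to at most [q(d)]. Second, the derivatives
    of [phi] are continuous but not controlled by [w], so integration by parts is legitimate only
    against kernels of compact support. Control returns after applying [T], because
    [T (B - lambda) phi = T psi - phi]. Cutoffs of radius [r] then cost [O(1/r)], which is paid for
    by one extra power of [1 + |t|] in the decay of [g]. Every vector integrand is continuous and
    dominated by a multiple of [1 / (1 + t^2)]; its Bochner integral is then a limit of explicit
    Riemann sums, and identities between integrals reduce to finite sums. *)

Section ComplexNorm.
Variable R : realType.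

Lemma rnormE (V : normedZmodType R[i]) (v : V) : `|v| = (rnorm v)%:C.
Proof. by rewrite /rnorm RRe_real; last exact: normr_real. Qed.

Lemma rnorm_ge0 (V : normedZmodType R[i]) (v : V) : 0 <= rnorm v.
Proof. by rewrite -lecR -rnormE; exact: normr_ge0. Qed.

Lemma rnorm0 (V : normedZmodType R[i]) : rnorm (0 : V) = 0.
Proof. by rewrite /rnorm normr0. Qed.

Lemma rnormN (V : normedZmodType R[i]) (v : V) : rnorm (- v) = rnorm v.
Proof. by rewrite /rnorm normrN. Qed.

Lemma rnorm_distC (V : normedZmodType R[i]) (u v : V) : rnorm (u - v) = rnorm (v - u).
Proof. by rewrite /rnorm distrC. Qed.

Lemma rnormD (V : normedZmodType R[i]) (u v : V) :
  rnorm (u + v) <= rnorm u + rnorm v.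
Proof. by rewrite -lecR raddfD /= -!rnormE ler_normD. Qed.

Lemma rnormB (V : normedZmodType R[i]) (u v : V) :
  rnorm (u - v) <= rnorm u + rnorm v.
Proof. by rewrite -(rnormN v) rnormD. Qed.

Lemma rnorm_split (V : normedZmodType R[i]) (u v z : V) :
  rnorm (u - v) <= rnorm (u - z) + rnorm (z - v).
Proof. by rewrite (le_trans _ (rnormD _ _))// addrA subrK. Qed.

Lemma rnorm_lip (V : normedZmodType R[i]) (u v : V) :
  `|rnorm u - rnorm v| <= rnorm (u - v).
Proof.
have := rnormD (u - v) v; have := rnormD (v - u) u.
rewrite !subrK (rnorm_distC v u) => h1 h2.
by rewrite ler_norml lerBlDr h2 andbT lerBrDr addrC lerBlDr addrC.
Qed.

Lemma rnorm_eq0 (V : normedZmodType R[i]) (v : V) : rnorm v = 0 -> v = 0.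
Proof. by move=> h; apply: normr0_eq0; rewrite rnormE h. Qed.

Lemma rnorm_sum (V : normedZmodType R[i]) (I : Type) (r : seq I) (P : pred I)
  (u : I -> V) :
  rnorm (\sum_(i <- r | P i) u i) <= \sum_(i <- r | P i) rnorm (u i).
Proof.
elim/big_rec2: _ => [|i x y _ h]; first by rewrite rnorm0.
by apply: le_trans (rnormD _ _) _; rewrite lerD2l.
Qed.

Lemma rnormM (a b : R[i]) : rnorm (a * b) = rnorm a * rnorm b.
Proof. by apply: complexI; rewrite -rnormE normrM !rnormE -rmorphM. Qed.

Lemma rnormX (a : R[i]) n : rnorm (a ^+ n) = rnorm a ^+ n.
Proof. by apply: complexI; rewrite -rnormE normrX !rnormE -rmorphXn. Qed.

Lemma rnormZ (V : normedModType R[i]) (a : R[i]) (v : V) :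
  rnorm (a *: v) = rnorm a * rnorm v.
Proof. by apply: complexI; rewrite -rnormE normrZ !rnormE -rmorphM. Qed.

Lemma rnorm_real (c : R) : rnorm (c%:C : R[i]) = `|c|.
Proof. by rewrite /rnorm normc_def /= expr0n /= addr0 sqrtr_sqr. Qed.

Lemma rnormZr (V : normedModType R[i]) (c : R) (v : V) :
  rnorm (c%:C *: v) = `|c| * rnorm v.
Proof. by rewrite rnormZ rnorm_real. Qed.

(** Positive elements of [R[i]] are real, so real [e] are enough. All later limits in [R[i]]-modules
    go through this form. *)
Lemma cvg_rnormP (V : normedModType R[i]) (T : Type) (F : set_system T)
  (FF : Filter F) (f : T -> V) (l : V) :
  f x @[x --> F] --> l <->
  forall e : R, 0 < e -> \forall x \near F, rnorm (l - f x) < e.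
Proof.
split=> [/cvgrPdist_lt h e e0|h].
  have := h e%:C; rewrite ltcR => /(_ e0).
  by apply: filterS => x; rewrite rnormE ltcR.
apply/cvgrPdist_lt => e e0.
have eE : e = (complex.Re e)%:C by rewrite RRe_real// gtr0_real.
rewrite eE ltcR in e0; apply: filterS (h _ e0) => x.
by rewrite rnormE eE ltcR.
Qed.

Lemma cvg_rnorm (V : normedModType R[i]) (T : Type) (F : set_system T)
  (FF : Filter F) (f : T -> V) (l : V) :
  f x @[x --> F] --> l -> rnorm (f x) @[x --> F] --> rnorm l.
Proof.
move=> /cvg_rnormP h; apply/cvgrPdist_lt => e /h; apply: filterS => x.
exact: le_lt_trans (rnorm_lip _ _).
Qed.

Lemma nbhs_realP (P : R -> Prop) (t : R) :
  (\forall x \near t, P x) <->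
  exists2 d : R, 0 < d & forall h, `|h| < d -> P (t + h).
Proof.
split=> [/nbhs_ballP[d /= d0 h]|[d d0 h]].
  exists d => // x xd; apply: h => /=.
  by rewrite -ball_normE /ball_/= opprD addrA subrr add0r normrN.
apply: (iffRL (nbhs_ballP _ _)); exists d => //= x; rewrite -ball_normE /ball_/= => xd.
by rewrite -(subrKC t x); apply: h; rewrite distrC.
Qed.

Lemma continuous_rnormP (V : normedModType R[i]) (u : R -> V) (t : R) :
  {for t, continuous u} <->
  forall e : R, 0 < e -> exists2 d, 0 < d &
    forall h, `|h| < d -> rnorm (u (t + h) - u t) < e.
Proof.
split=> [/cvg_rnormP h e /h/nbhs_realP[d d0 dh]|h].
  by exists d => // x /dh; rewrite rnorm_distC.
apply/cvg_rnormP => e /h[d d0 dh]; apply/nbhs_realP; exists d => // x /dh.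
by rewrite rnorm_distC.
Qed.

Lemma continuous_bounded (V : normedModType R[i]) (u : R -> V) (r : R) : continuous u ->
  exists2 M : R, 0 <= M & forall s, `|s| <= r -> rnorm (u s) <= M.
Proof.
(* The extreme value theorem needs ordered end points, and [r] may be negative. *)
move=> uc; pose r' := Num.max 0 r.
have cu : continuous (fun s => rnorm (u s)) by move=> s; apply: cvg_rnorm; exact: uc.
have [||c _ hc] := @EVT_max R (fun s => rnorm (u s)) (- r') r'.
  by rewrite ge0_cp// /r' le_max lexx.
  exact: continuous_subspaceT.
exists (rnorm (u c)) => [|s sr]; first exact: rnorm_ge0.
apply: hc; rewrite in_itv/= -ler_norml (le_trans sr)//.
by rewrite /r' le_max lexx orbT.
Qed.

End ComplexNorm.

(** The additive skeleton of the product rule: [x] and [p] are the products at [t + h] and [t], [s]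
    and [y] the mixed products, [q] and [r] the two first-order terms. The last summand is the
    product of the two increments. *)
Lemma zmod_product_rule (V : zmodType) (x p q r s y : V) :
  x - p - (q + r) = s - p - q + (y - p - r) + (x - s - (y - p)).
Proof.
rewrite opprD opprB.
rewrite [RHS](AC (3*3*(2*2)) ((7*2*(3*6))*((1*8)*((4*10)*(9*5)))))/=.
by rewrite !subrr !addr0.
Qed.

(** Dividing the tolerance by [1 + U] instead of [U] allows [U = 0]. *)
Lemma ler_scaled_mul (R : realFieldType) (x a U h : R) :
  0 <= U -> 0 <= a -> 0 <= h -> x <= a / (1 + U) * h -> x * U <= a * h.
Proof.
move=> U0 a0 h0 /(ler_wpM2r U0) xle; apply: le_trans xle _.
rewrite (_ : _ * U = a * h * (U / (1 + U))); last by field; lra.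
by rewrite ler_piMr ?mulr_ge0// ler_pdivrMr ?mul1r; lra.
Qed.

(** * Derivatives in remainder form and the mean value inequality *)

Section Derivatives.
Variable R : realType.

(** The remainder form holds trivially at [h = 0], so no punctured neighbourhood or limit value has
    to be handled. Only [u' t] matters; a function is passed so that lists of successive derivatives
    can be formed. *)
Definition has_der (V : normedModType R[i]) (u u' : R -> V) (t : R) : Prop :=
  forall e : R, 0 < e -> exists2 d : R, 0 < d & forall h, `|h| < d ->
    rnorm (u (t + h) - u t - h%:C *: u' t) <= e * `|h|.

Lemma has_der_lip (V : normedModType R[i]) (u u' : R -> V) t : has_der u u' t ->
  exists2 d : R, 0 < d & forall h, `|h| < d ->
    rnorm (u (t + h) - u t) <= (1 + rnorm (u' t)) * `|h|.
Proof.
move=> /(_ _ ltr01)[d d0 dh]; exists d => // h /dh k.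
rewrite mulrDl [rnorm (u' t) * _]mulrC -rnormZr.
rewrite -(subrK (h%:C *: u' t) (u (t + h) - u t)).
by apply: le_trans (rnormD _ _) _; rewrite lerD2r.
Qed.

Lemma has_der_continuous (V : normedModType R[i]) (u u' : R -> V) t :
  has_der u u' t -> {for t, continuous u}.
Proof.
move=> /has_der_lip[d d0 dh]; apply/continuous_rnormP => e e0.
set c := 1 + rnorm (u' t) in dh.
have c0 : 0 < c by rewrite ltr_pwDl// rnorm_ge0.
exists (Num.min d (e / c)); first by rewrite lt_min d0 divr_gt0.
move=> h; rewrite lt_min => /andP[hd he]; apply: le_lt_trans (dh _ hd) _.
by rewrite mulrC -ltr_pdivlMr.
Qed.

Lemma has_derD (V : normedModType R[i]) (u u' v v' : R -> V) t :
  has_der u u' t -> has_der v v' t ->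
  has_der (fun s => u s + v s) (fun s => u' s + v' s) t.
Proof.
move=> hu hv e e0.
have e20 : 0 < e / 2 by rewrite divr_gt0.
have [d d0 dh] := hu _ e20; have [d' d'0 d'h] := hv _ e20.
exists (Num.min d d'); first by rewrite lt_min d0 d'0.
move=> h; rewrite lt_min => /andP[/dh k /d'h k'].
rewrite (_ : _ - _ = (u (t + h) - u t - h%:C *: u' t) +
  (v (t + h) - v t - h%:C *: v' t)); last first.
  by rewrite scalerDr !opprD [LHS](AC (2*2*2) (1*3*5*(2*4*6))).
by apply: le_trans (rnormD _ _) _; rewrite [e]splitr mulrDl lerD.
Qed.

Lemma has_der_cst (V : normedModType R[i]) (c : V) t :
  has_der (fun=> c) (fun=> 0) t.
Proof.
move=> e e0; exists 1 => // h _.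
by rewrite subrr scaler0 subr0 rnorm0 mulr_ge0 // ltW.
Qed.

Lemma has_derM (V : normedModType R[i]) (f f' : R -> R[i]) (u u' : R -> V) t :
  has_der (f : R -> R[i]^o) f' t -> has_der u u' t ->
  has_der (fun s => f s *: u s) (fun s => f' s *: u s + f s *: u' s) t.
Proof.
move=> hf hu e e0.
have [df df0 dfh] := has_der_lip hf.
set c := 1 + rnorm (f' t) in dfh.
have c0 : 0 < c by rewrite ltr_pwDl// rnorm_ge0.
have [du du0 duh] := has_der_lip hu.
set c' := 1 + rnorm (u' t) in duh.
have c'0 : 0 < c' by rewrite ltr_pwDl// rnorm_ge0.
have a0 : 0 < e / 3 / (1 + rnorm (u t)).
  by rewrite !divr_gt0// ltr_pwDl// rnorm_ge0.
have b0 : 0 < e / 3 / (1 + rnorm (f t)).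
  by rewrite !divr_gt0// ltr_pwDl// rnorm_ge0.
have [d1 d10 d1h] := hf _ a0; have [d2 d20 d2h] := hu _ b0.
(* The last entry makes the product of increments, at most [c * c' * |h|^2], smaller than
   [e / 3 * |h|]. *)
exists (Num.min (Num.min df du) (Num.min (Num.min d1 d2) (e / 3 / (c * c')))).
  by rewrite !lt_min df0 du0 d10 d20 !divr_gt0// mulr_gt0.
move=> h; rewrite !lt_min => /andP[/andP[h1 h2] /andP[/andP[h3 h4] h5]].
rewrite (_ : _ - _ = (f (t + h) - f t - h%:C * f' t) *: u t +
  f t *: (u (t + h) - u t - h%:C *: u' t) +
  (f (t + h) - f t) *: (u (t + h) - u t)); last first.
  rewrite !scalerBl !scalerBr !scalerDr !scalerA [f t * h%:C]mulrC.
  exact: zmod_product_rule.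
have k1 := d1h _ h3; have k2 := d2h _ h4.
have k3 := dfh _ h1; have k4 := duh _ h2.
apply: le_trans (rnormD _ _) _; apply: le_trans (lerD (rnormD _ _) (lexx _)) _.
rewrite !rnormZ.
have -> : e * `|h| = e / 3 * `|h| + e / 3 * `|h| + e / 3 * `|h| by field.
have nneg := rnorm_ge0 (u t); have nnegf := rnorm_ge0 (f t).
apply: lerD; first apply: lerD.
- by apply: ler_scaled_mul k1; rewrite // divr_ge0 // ltW.
- by rewrite mulrC; by apply: ler_scaled_mul k2; rewrite // divr_ge0 // ltW.
- apply: le_trans (ler_pM _ _ k3 k4) _; rewrite ?rnorm_ge0//.
  rewrite mulrACA mulrA ler_wpM2r//.
  by rewrite mulrC -ler_pdivlMr ?mulr_gt0// ltW.
Qed.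

Lemma has_derZ (V : normedModType R[i]) (c : R[i]) (u u' : R -> V) t :
  has_der u u' t -> has_der (fun s => c *: u s) (fun s => c *: u' s) t.
Proof.
move=> hu; have := has_derM (has_der_cst (c : R[i]^o) t) hu.
by congr has_der; apply/funext => s; rewrite scale0r add0r.
Qed.

Lemma has_derB (V : normedModType R[i]) (u u' v v' : R -> V) t :
  has_der u u' t -> has_der v v' t ->
  has_der (fun s => u s - v s) (fun s => u' s - v' s) t.
Proof.
move=> hu /(has_derZ (-1)) hv; have := has_derD hu hv.
by congr has_der; apply/funext => s; rewrite scaleN1r.
Qed.

Lemma has_der_linear (V : normedModType R[i]) (c : V) t :
  has_der (fun s => s%:C *: c) (fun=> c) t.
Proof.
move=> e e0; exists 1 => // h _.
by rewrite rmorphD scalerDl [_ + _ - t%:C *: c]addrAC subrr add0r subrr rnorm0 mulr_ge0 // ltW.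
Qed.

Lemma has_der_sum (V : normedModType R[i]) (I : Type) (r : seq I)
  (u u' : I -> R -> V) t : (forall i, has_der (u i) (u' i) t) ->
  has_der (fun s => \sum_(i <- r) u i s) (fun s => \sum_(i <- r) u' i s) t.
Proof.
move=> h; elim: r => [|i r IH].
  have := has_der_cst (0 : V) t.
  by congr has_der; apply/funext => s; rewrite big_nil.
have := has_derD (h i) IH.
by congr has_der; apply/funext => s; rewrite big_cons.
Qed.

Lemma has_der_scale (V : normedModType R[i]) (c : R) (u u' : R -> V) t :
  has_der u u' (c * t) ->
  has_der (fun s => u (c * s)) (fun s => c%:C *: u' (c * s)) t.
Proof.
move=> hu e e0; have c0 : 0 < 1 + `|c| by rewrite ltr_pwDl.
have [d d0 dh] := hu _ (divr_gt0 e0 c0).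
exists (d / (1 + `|c|)) => [|h]; first by rewrite divr_gt0.
rewrite ltr_pdivlMr// => hd; rewrite mulrDr scalerA -rmorphM [h * c]mulrC.
have : `|c * h| < d.
  rewrite normrM; apply: le_lt_trans hd; rewrite mulrC ler_wpM2l//.
  by rewrite ler_wpDl.
move=> /dh/le_trans; apply; rewrite normrM -mulrA ler_pM2l//.
rewrite mulrA ler_piMl// mulrC ler_pdivrMr// mul1r.
by rewrite ler_wpDl.
Qed.

Lemma has_der_reflect (V : normedModType R[i]) (a : R) (u u' : R -> V) t :
  has_der u u' (a - t) ->
  has_der (fun s => u (a - s)) (fun s => - u' (a - s)) t.
Proof.
move=> hu e e0; have [d d0 dh] := hu _ e0.
exists d => // h; rewrite -normrN => hd; have := dh _ hd.
by rewrite opprD addrA rmorphN scaleNr scalerN.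
Qed.

Lemma has_der_quotient (V : completeNormedModType R[i]) (u : R -> V) (t : R) (l : V) :
  diff_quotient u t h @[h --> (0 : R)^'] --> l -> has_der u (fun=> l) t.
Proof.
move=> /cvg_rnormP h e /h; rewrite near_withinE => /nbhs_realP[d d0 dh].
exists d => // x xd; have [->|x0] := eqVneq x 0.
  by rewrite addr0 subrr sub0r scale0r oppr0 rnorm0 normr0 mulr0.
have := dh _ xd; rewrite add0r => /(_ x0)/ltW k.
rewrite (_ : _ - _ = x%:C *: ((x^-1)%:C *: (u (t + x) - u t) - l)).
  by rewrite rnormZr mulrC ler_wpM2r// rnorm_distC.
by rewrite scalerBr scalerA -rmorphM divff// scale1r.
Qed.

Lemma is_derive_has_der (f f' : R -> R) (t : R) : is_derive t (1 : R) f (f' t) ->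
  has_der (fun s => (f s)%:C : R[i]^o) (fun s => (f' s)%:C) t.
Proof.
move=> [df fE] e e0; have := df; rewrite /derivable -[lim _]/('D_1 f t) fE.
move=> /cvgrPdist_lt /(_ _ e0); rewrite near_withinE => /nbhs_realP[d d0 dh].
exists d => // x xd; have [->|x0] := eqVneq x 0.
  by rewrite addr0 subrr sub0r scale0r oppr0 rnorm0 normr0 mulr0.
have := dh _ xd; rewrite add0r => /(_ x0)/ltW /=.
rewrite -[x%:C *: _]/(x%:C * (f' t)%:C) -rmorphM -!rmorphB rnorm_real => k.
rewrite (_ : _ - _ = x * (x^-1 * (f (t + x) - f t) - f' t)).
  rewrite normrM mulrC ler_wpM2r// distrC; move: k.
  by rewrite /GRing.scale/= mulr1 [x + t]addrC.
by rewrite mulrBr mulrA divff// mul1r.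
Qed.

(* By real induction: the points up to which the bound holds have supremum [b]. *)
Lemma mean_value_le (V : normedModType R[i]) (u u' : R -> V) (a b M : R) :
  a <= b -> (forall t, a <= t <= b -> has_der u u' t) ->
  (forall t, a <= t <= b -> rnorm (u' t) <= M) ->
  rnorm (u b - u a) <= M * (b - a).
Proof.
move=> ab du leM; apply/ler_addgt0Pr => e0 e00.
(* The slope is relaxed to [M + e]; over the whole interval this costs at most [e0]. *)
pose e := e0 / (1 + (b - a)).
have e_gt0 : 0 < e by rewrite divr_gt0// ltr_pwDl// subr_ge0.
apply: (@le_trans _ _ ((M + e) * (b - a))); last first.
  rewrite mulrDl lerD2l /e mulrAC ler_pdivrMr ?ltr_pwDl ?subr_ge0//.
  by rewrite ler_pM2l// ler_wpDl.
pose K x := rnorm (u x - u a) <= (M + e) * (x - a).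
pose S := [set x | a <= x <= b /\ forall y, a <= y <= x -> K y].
have Ka : K a by rewrite /K !subrr rnorm0 mulr0.
have Sa : S a.
  split; first by rewrite lexx.
  by move=> y; rewrite -eq_le => /eqP <-.
have hS : has_sup S by split; [exists a|exists b => x [/andP[]]].
have as_ : a <= sup S by apply: ub_le_sup => //; case: hS.
have sb : sup S <= b by apply: ge_sup => [|x [/andP[]]]//; exists a.
set s := sup S in as_ sb.
have [d d0 dh] := du s (introT andP (conj as_ sb)) _ e_gt0.
have step h : `|h| < d -> rnorm (u (s + h) - u s) <= (M + e) * `|h|.
  move=> /dh k; rewrite -(subrK (h%:C *: u' s) (u (s + h) - u s)).
  apply: le_trans (rnormD _ _) _; rewrite rnormZr addrC mulrDl.
  by rewrite lerD// mulrC ler_wpM2r// leM// as_.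
have Klt y : a <= y -> y < s -> K y.
  move=> ay ys; have sy0 : 0 < s - y by rewrite subr_gt0.
  have [x [_ Sx] yx] := sup_adherent sy0 hS.
  apply: Sx; rewrite ay ltW//; move: yx; rewrite -/s; lra.
(* The bound reaches the supremum itself through a point [y] at most [d / 2] below it, where the
   derivative at [s] controls the rest. *)
have Ks : K s.
  have [sa|] := eqVneq s a; first by rewrite sa.
  move=> sa; have {sa} sa : a < s by rewrite lt_neqAle eq_sym sa.
  pose y := Num.max a (s - d / 2).
  have ys : y < s by rewrite /y gt_max sa /=; lra.
  have Ky : K y by apply: Klt => //; rewrite /y le_max lexx.
  rewrite /K; apply: le_trans (rnorm_split _ _ (u y)) _.
  rewrite (_ : _ * _ = (M + e) * (s - y) + (M + e) * (y - a)); last by ring.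
  apply: lerD Ky; rewrite rnorm_distC.
  have /step : `|y - s| < d.
    have ymin : s - d / 2 <= y by rewrite le_max lexx orbT.
    rewrite ltr0_norm ?subr_lt0// opprB; lra.
  by rewrite subrKC ltr0_norm ?subr_lt0// opprB.
have Kgt h : 0 <= h -> h < d -> K (s + h).
  move=> h0 hd; apply: le_trans (rnorm_split _ _ (u s)) _.
  rewrite (_ : _ * _ = (M + e) * h + (M + e) * (s - a)); last by ring.
  by apply: lerD Ks; have := step h; rewrite ger0_norm//; apply.
have [bs|sb'] := leP b s.
  by have -> : b = s by apply/eqP; rewrite eq_le bs.
(* If [s < b], this puts a point beyond [s] into [S], against the choice of [s] as supremum. *)
have : S (Num.min b (s + d / 2)).
  split; first by rewrite le_min ab ge_min lexx /= andbT; lra.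
  move=> y /andP[ay]; rewrite le_min => /andP[yb ysd].
  have [ys|sy] := ltP y s; first exact: Klt.
  by rewrite -(subrK s y) addrC; apply: Kgt; lra.
move=> /(ub_le_sup hS.2); rewrite -/s ge_min => /orP[]; lra.
Qed.

End Derivatives.

(** * Bochner integral: simple functions and uniqueness *)

Lemma ereal_cvg0_lt (R : realType) (f : nat -> \bar R) :
  f n @[n --> \oo] --> 0%E ->
  forall e : R, 0 < e -> \forall n \near \oo, (f n < e%:E)%E.
Proof.
move=> /fine_cvgP[fin /cvgrPdist_lt fine_lt] e /fine_lt {}fine_lt.
near=> n; have fn : f n \is a fin_num by near: n.
rewrite -(fineK fn) lte_fin; have : `|0 - fine (f n)| < e by near: n.
by rewrite sub0r normrN; apply: le_lt_trans; exact: ler_norm.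
Unshelve. all: by end_near.
Qed.

Section SimpleFunctions.
Variables (R : realType) (V : normedModType R[i]).
Let mu := @lebesgue_measure R.

(** The offset [y] makes induction on the number of sets possible: on the last set its vector joins
    the offset, elsewhere the offset is unchanged. *)
Lemma simple_sumS n (E : 'I_n.+1 -> set R) (x : 'I_n.+1 -> V) (y : V) t :
  y + \sum_(i < n.+1) (\1_(E i) t)%:C *: x i =
  (if t \in E ord_max then y + x ord_max else y) +
  \sum_(i < n) (\1_(E (widen_ord (leqnSn n) i)) t)%:C *:
    x (widen_ord (leqnSn n) i).
Proof.
rewrite big_ord_recr /= addrCA addrC [X in X + _](_ : _ = if t \in E ord_max
  then y + x ord_max else y)//; rewrite indicE.
by case: ifP => _; rewrite ?scale1r ?scale0r ?addr0.
Qed.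

Lemma measurable_simple_norm n (E : 'I_n -> set R) (x : 'I_n -> V) (y : V) :
  (forall i, measurable (E i)) ->
  measurable_fun setT
    (fun t => rnorm (y + \sum_(i < n) (\1_(E i) t)%:C *: x i)).
Proof.
elim: n => [|n IH] in E x y * => mE.
  by under eq_fun do rewrite big_ord0 addr0; exact: measurable_cst.
under eq_fun do rewrite simple_sumS.
rewrite (_ : (fun t => _) = fun t => if t \in E ord_max
  then rnorm (y + x ord_max + \sum_(i < n)
    (\1_(E (widen_ord (leqnSn n) i)) t)%:C *: x (widen_ord (leqnSn n) i))
  else rnorm (y + \sum_(i < n)
    (\1_(E (widen_ord (leqnSn n) i)) t)%:C *: x (widen_ord (leqnSn n) i))).
  apply: measurable_fun_ifT; [|exact: IH|exact: IH].
  by apply: (measurable_fun_bool true); rewrite setTI preimage_mem_true.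
by apply/funext => t; case: ifP.
Qed.

(* Splitting [A] along the last set of the family avoids decomposing the
   simple function over the atoms generated by the [E i]. *)
Lemma simple_norm_le n (E : 'I_n -> set R) (x : 'I_n -> V) (y : V) (A : set R) :
  (forall i, measurable (E i) /\ (mu (E i) < +oo)%E) ->
  measurable A -> y = 0 \/ (mu A < +oo)%E ->
  ((rnorm ((fine (mu A))%:C *: y +
    \sum_(i < n) (fine (mu (E i `&` A)))%:C *: x i))%:E <=
   \int[mu]_(t in A) (rnorm (y + \sum_(i < n) (\1_(E i) t)%:C *: x i))%:E)%E.
Proof.
elim: n => [|n IH] in E x y A * => mE mA hA.
  under eq_integral do rewrite big_ord0 addr0.
  rewrite big_ord0 addr0 [leRHS](integral_cst mu mA (rnorm y)%:E).
  case: hA => [->|hA]; first by rewrite scaler0 rnorm0 mul0e.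
  by rewrite rnormZr ger0_norm ?fine_ge0// EFinM muleC fineK// ge0_fin_numE.
have [mL fL] := mE ord_max; set L := E ord_max in mL fL *.
have mE' i : measurable (E (widen_ord (leqnSn n) i)) /\
  (mu (E (widen_ord (leqnSn n) i)) < +oo)%E by exact: mE.
have mf (B : set R) : measurable_fun B
    (EFin \o (fun t => rnorm (y + \sum_(i < n.+1) (\1_(E i) t)%:C *: x i))).
  apply/measurable_EFinP; apply: (measurable_funS measurableT) => //.
  by apply: measurable_simple_norm => i; have [] := mE i.
have mAL : measurable (A `&` L) by exact: measurableI.
have mADL : measurable (A `\` L) by exact: measurableD.
rewrite -[in leRHS](setUIDK A L) ge0_integral_setU; last first.
- by apply/disj_setPS => t [[_ tL] [_ /(_ tL)]].
- by move=> t _; rewrite lee_fin rnorm_ge0.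
- exact: mf.
- exact: mADL.
- exact: mAL.
pose x' i := x (widen_ord (leqnSn n) i).
have fin (B C : set R) : measurable B -> measurable C -> (mu B < +oo)%E ->
    (mu (B `&` C) < +oo)%E.
  by move=> mB mC; apply: le_lt_trans; exact: measureIl.
(* [fine] is additive on finite measures only, so a nonzero offset is carried over sets of finite
   measure only; the offset created on [L] qualifies because [L] has finite measure. *)
have h1 : y + x ord_max = 0 \/ (mu (A `&` L) < +oo)%E.
  by right; rewrite setIC fin.
have h2 : y = 0 \/ (mu (A `\` L) < +oo)%E.
  case: hA => [->|hA]; [by left|right].
  by apply: le_lt_trans hA; apply: measureIl => //; exact: measurableC.
have h := leeD (IH _ x' _ _ mE' mAL h1) (IH _ x' _ _ mE' mADL h2).
apply: le_trans (le_trans h _).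
  rewrite -EFinD lee_fin; apply: le_trans (rnormD _ _).
  rewrite le_eqVlt; apply/orP; left; apply/eqP.
  congr rnorm.
  have add (B : set R) : measurable B -> (mu B < +oo)%E ->
     fine (mu (B `&` A)) = fine (mu (B `&` (A `&` L))) + fine (mu (B `&` (A `\` L))).
    move=> mB fB.
    have -> : mu (B `&` A) = (mu (B `&` (A `\` L)) + mu (B `&` (A `&` L)))%E.
      rewrite [LHS](measureDI mu (B := L))//; last exact: measurableI.
      by rewrite setIA setIDA.
    by rewrite fineD ?ge0_fin_numE ?fin// addrC.
  rewrite big_ord_recr /= setIC -/L scalerDr.
  rewrite [RHS](AC (3*2) (1*4*(3*5)*2)) -big_split /= -scalerDl -rmorphD /=.
  rewrite addrA; congr (_ + _ + _).
    case: hA => [->|hA]; first by rewrite !scaler0.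
    have f1 : (mu (A `&` L) < +oo)%E by rewrite setIC fin.
    have f2 : (mu (A `\` L) < +oo)%E.
      by apply: le_lt_trans hA; apply: measureIl => //; exact: measurableC.
    have -> : mu A = (mu (A `\` L) + mu (A `&` L))%E by rewrite -measureDI.
    by rewrite fineD ?ge0_fin_numE// addrC.
  apply: eq_bigr => i _; have [mi fi] := mE' i.
  by rewrite add// rmorphD /= scalerDl.
apply: leeD; rewrite le_eqVlt; apply/orP; left; apply/eqP.
  apply: eq_integral => t; rewrite inE => -[_ tL].
  by rewrite simple_sumS mem_set.
apply: eq_integral => t; rewrite inE => -[_ tL].
by rewrite simple_sumS memNset.
Qed.

(** The preceding lemma with [y = 0] and [A] the whole line. Applied to differences, it makes the
    integral of a simple function independent of its representation. *)
Lemma simple_norm_integral (s : R -> V) (v : V) : simple_with_integral s v ->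
  ((rnorm v)%:E <= \int[mu]_t (rnorm (s t))%:E)%E.
Proof.
move=> [n [E [x [mE sE ->]]]].
have := simple_norm_le x mE measurableT (or_introl (erefl 0)).
rewrite scaler0 add0r => h; apply: le_trans (le_trans h _).
  rewrite lee_fin le_eqVlt; apply/orP; left; apply/eqP; congr rnorm.
  by apply: eq_bigr => i _; rewrite (setIT (E i)).
rewrite le_eqVlt; apply/orP; left; apply/eqP.
by apply: eq_integral => t _; rewrite add0r -sE.
Qed.

Lemma simple_measurable_norm (s : R -> V) (v : V) : simple_with_integral s v ->
  measurable_fun setT (fun t => rnorm (s t)).
Proof.
move=> [n [E [x [mE sE _]]]].
have := @measurable_simple_norm n E x 0 (fun i => (mE i).1).
by under eq_fun do rewrite add0r -sE.
Qed.

Lemma simple_sub (s s' : R -> V) (v v' : V) :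
  simple_with_integral s v -> simple_with_integral s' v' ->
  simple_with_integral (fun t => s t - s' t) (v - v').
Proof.
move=> [n [E [x [mE sE ->]]]] [n' [E' [x' [mE' sE' ->]]]].
exists (n + n')%N, (fun i => match fintype.split i with inl j => E j | inr k => E' k end).
exists (fun i => match fintype.split i with inl j => x j | inr k => - x' k end).
split.
- by move=> i; case: (fintype.split i).
- move=> t; rewrite sE sE' big_split_ord/= -sumrN; congr (_ + _).
    by apply: eq_bigr => i _; rewrite (unsplitK (inl i)).
  by apply: eq_bigr => i _; rewrite (unsplitK (inr i)) scalerN.
- rewrite big_split_ord/= -sumrN; congr (_ + _).
    by apply: eq_bigr => i _; rewrite (unsplitK (inl i)).
  by apply: eq_bigr => i _; rewrite (unsplitK (inr i)) scalerN.
Qed.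

Lemma simple0 : simple_with_integral (fun=> 0 : V) 0.
Proof.
exists 0%N, (fun=> set0), (fun=> 0); split; first by case.
  by move=> t; rewrite big_ord0.
by rewrite big_ord0.
Qed.

(** Pointwise convergence alone already makes the norm of [g - s] measurable, as splitting the
    integral of a sum requires. *)
Definition strongly_measurable (g : R -> V) : Prop :=
  exists2 s : nat -> R -> V, (forall n, exists v, simple_with_integral (s n) v) &
    forall t, s n t @[n --> \oo] --> g t.

Lemma strongly_measurable_norm (g s : R -> V) (v : V) :
  strongly_measurable g -> simple_with_integral s v ->
  measurable_fun setT (fun t => rnorm (g t - s t)).
Proof.
move=> [sn snE sng] sv.
apply: (@measurable_fun_cvg _ _ _ _ (fun n t => rnorm (sn n t - s t))) => [n|t _].
  by have [vn svn] := snE n; apply: simple_measurable_norm (simple_sub svn sv).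
by apply: cvg_rnorm; apply: cvgB; [exact: sng|exact: cvg_cst].
Qed.

(** Pointwise triangle inequality through [g]. It gives the Cauchy property of the integrals of
    approximating simple functions. *)
Lemma simple_dist_le (g s s' : R -> V) (v v' : V) : strongly_measurable g ->
  simple_with_integral s v -> simple_with_integral s' v' ->
  ((rnorm (v - v'))%:E <= \int[mu]_t (rnorm (g t - s t))%:E +
    \int[mu]_t (rnorm (g t - s' t))%:E)%E.
Proof.
move=> mg sv sv'.
have h := simple_norm_integral (simple_sub sv sv').
have m1 := strongly_measurable_norm mg sv.
have m2 := strongly_measurable_norm mg sv'.
rewrite -ge0_integralD//; first last.
- exact/measurable_EFinP.
- by move=> t _; rewrite lee_fin rnorm_ge0.
- exact/measurable_EFinP.
- by move=> t _; rewrite lee_fin rnorm_ge0.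
apply: (le_trans h); apply: ge0_le_integral => //.
- by move=> t _; rewrite lee_fin rnorm_ge0.
- by apply/measurable_EFinP; exact: simple_measurable_norm (simple_sub sv sv').
- by apply: emeasurable_funD; exact/measurable_EFinP.
- move=> t _; rewrite lee_fin; apply: le_trans (rnorm_split _ _ (g t)) _.
  by rewrite rnorm_distC.
Qed.

Lemma bochner_strongly_measurable (g : R -> V) (v : V) :
  is_bochner_integral g v -> strongly_measurable g.
Proof.
by move=> [s [I [sI sg _ _]]]; exists s => // n; exists (I n).
Qed.

(** Limit of [simple_dist_le] along the simple functions that define [v]. *)
Lemma bochner_dist_le (g s : R -> V) (v v0 : V) :
  is_bochner_integral g v -> simple_with_integral s v0 ->
  ((rnorm (v - v0))%:E <= \int[mu]_t (rnorm (g t - s t))%:E)%E.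
Proof.
move=> gv sv0; have mg := bochner_strongly_measurable gv.
case: gv => sn [I [sI _ sn0 Iv]].
apply/lee_addgt0Pr => e e0; have e20 : 0 < e / 2 by rewrite divr_gt0.
move/cvg_rnormP : Iv => /(_ _ e20) h1.
have h2 := ereal_cvg0_lt sn0 e20.
have [n [h1n h2n]] : exists n, rnorm (v - I n) < e / 2 /\
    (\int[mu]_t (rnorm (g t - sn n t))%:E < (e / 2)%:E)%E.
  have [N _ h] : \forall n \near \oo, rnorm (v - I n) < e / 2 /\
    (\int[mu]_t (rnorm (g t - sn n t))%:E < (e / 2)%:E)%E by near do split.
  by exists N; apply: h => /=.
apply: (@le_trans _ _ ((e / 2)%:E + (rnorm (I n - v0))%:E)%E).
  by rewrite -EFinD lee_fin (le_trans (rnorm_split _ _ (I n)))// lerD2r ltW.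
rewrite (_ : e%:E = (e / 2)%:E + (e / 2)%:E)%E; last by rewrite -EFinD -splitr.
rewrite addeCA leeD2l// addeC.
by apply: (le_trans (simple_dist_le mg (sI n) sv0)); rewrite leeD2r// ltW.
Unshelve. all: by end_near.
Qed.

(** By [bochner_dist_le], the integrals [I n] that define [v'] also converge to [v]. *)
Lemma bochner_unique (g : R -> V) (v v' : V) :
  is_bochner_integral g v -> is_bochner_integral g v' -> v = v'.
Proof.
move=> gv [s [I [sI sg s0 Iv']]].
suff : I n @[n --> \oo] --> v by move/cvg_unique; apply.
apply/cvg_rnormP => e e0.
have h := ereal_cvg0_lt s0 e0.
near=> n; rewrite -lte_fin; apply: (le_lt_trans (bochner_dist_le gv (sI n))).
by near: n.
Unshelve. all: by end_near.
Qed.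

Lemma bochner_integralE (g : R -> V) (v : V) :
  is_bochner_integral g v -> bochner_integral g = v.
Proof.
move=> gv; apply: (bochner_unique _ gv).
by rewrite /bochner_integral; case: xgetP => [x _|/(_ _ gv)].
Qed.

End SimpleFunctions.

(** * Bochner integral: Riemann sums *)

Section Kappa.
Variable R : realType.
Let mu := @lebesgue_measure R.

(** The universal majorant: integrable over the line, with integral [pi], and comparable to its
    translates by at most 1, so that it also dominates step functions. *)
Definition kappa (t : R) : R := (1 + t ^+ 2)^-1.

Lemma kappa_gt0 t : 0 < kappa t.
Proof. by rewrite invr_gt0 ltr_pwDl// sqr_ge0. Qed.

Lemma kappa_ge0 t : 0 <= kappa t.
Proof. exact/ltW/kappa_gt0. Qed.

Lemma continuous_kappa : continuous kappa.
Proof. exact: continuous_oneDsqrV. Qed.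

Lemma measurable_kappa : measurable_fun setT kappa.
Proof. by apply: continuous_measurable_fun; exact: continuous_kappa. Qed.

Lemma integral_kappa : (\int[mu]_t (kappa t)%:E = pi%:E)%E.
Proof.
rewrite ge0_symfun_integralT; first last.
- by move=> t; rewrite /kappa /= sqrrN.
- exact: continuous_kappa.
- exact: kappa_ge0.
rewrite (_ : [set x | _] = `[0, +oo[%classic); last first.
  by apply/seteqP; split => x /=; rewrite in_itv/= andbT.
by rewrite integral0y_oneDsqr -EFinM mulrCA divff ?mulr1.
Qed.

Lemma integral_kappaZ (c : R) : 0 <= c ->
  (\int[mu]_t (c * kappa t)%:E = (c * pi)%:E)%E.
Proof.
move=> c0; under eq_integral do rewrite EFinM.
rewrite ge0_integralZl ?integral_kappa//.
- by apply/measurable_EFinP; exact: measurable_kappa.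
- by move=> t _; rewrite lee_fin kappa_ge0.
Qed.

Lemma integrable_kappaZ (c : R) : 0 <= c ->
  mu.-integrable setT (EFin \o (fun t => c * kappa t)).
Proof.
move=> c0; apply/integrableP; split.
  by apply/measurable_EFinP; apply: measurable_funM => //; exact: measurable_kappa.
rewrite (_ : (fun x => _) = fun t => (c * kappa t)%:E).
  by rewrite integral_kappaZ// ltry.
by apply/funext => t /=; rewrite ger0_norm// mulr_ge0// kappa_ge0.
Qed.

Lemma kappa_dominated (f : nat -> R -> R) (c : R) :
  (forall n, measurable_fun setT (f n)) ->
  (forall n t, 0 <= f n t <= c * kappa t) ->
  (forall t, f n t @[n --> \oo] --> (0 : R)) ->
  (\int[mu]_t (f n t)%:E)%E @[n --> \oo] --> 0%E.
Proof.
move=> mf fk f0.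
have c0 : 0 <= c.
  rewrite -(pmulr_lge0 _ (kappa_gt0 0)).
  by have /andP[] := fk 0%N 0; exact: le_trans.
have mf' n : measurable_fun setT (EFin \o f n) by apply/measurable_EFinP.
case: (@dominated_convergence _ _ R mu setT measurableT
  (fun n => EFin \o f n) (cst 0%E) (EFin \o (fun t => c * kappa t)) mf').
- exact: measurable_cst.
- apply: aeW => t _ /=; apply/fine_cvgP; split; first by near=> n.
  exact: f0.
- exact: integrable_kappaZ.
- apply: aeW => t n _ /=; rewrite lee_fin.
  by have /andP[f0n fkn] := fk n t; rewrite ger0_norm.
move=> _ _; rewrite integral0; exact.
Unshelve. all: by end_near.
Qed.

Lemma kappa_shift (s t : R) : `|t - s| <= 1 -> kappa s <= 3 * kappa t.
Proof.
rewrite ler_norml => /andP[h1 h2].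
rewrite /kappa -[3]invrK -invfM lef_pV2 ?posrE ?mulr_gt0 ?ltr_pwDl ?sqr_ge0 ?invr_gt0//.
(* [3 (1 + s^2) - (1 + t^2) = (2 s - t)^2 + s^2 + 2 (1 - (t - s)^2)]. *)
rewrite ler_pdivrMl//; have := sqr_ge0 (2 * s - t); nra.
Qed.

Lemma integral_kappa_le (f : R -> R) (c : R) : 0 <= c ->
  measurable_fun setT f -> (forall t, 0 <= f t <= c * kappa t) ->
  (\int[mu]_t (f t)%:E <= (c * pi)%:E)%E.
Proof.
move=> c0 mf fk; rewrite -integral_kappaZ//; apply: ge0_le_integral => //.
- by move=> t _; rewrite lee_fin; have /andP[] := fk t.
- exact/measurable_EFinP.
- apply/measurable_EFinP; apply: measurable_funM => //; exact: measurable_kappa.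
- by move=> t _; rewrite lee_fin; have /andP[] := fk t.
Qed.

End Kappa.

(** * Step functions on a grid and their Riemann sums *)

Section Riemann.
Variables (R : realType).
Let mu := @lebesgue_measure R.

(** The grid covers [[-(n+1), n+1[] with mesh [1/(n+1)]: a single index both refines the mesh and
    exhausts the line. *)
Definition node (n i : nat) : R := - n.+1%:R + i%:R / n.+1%:R.
Definition cell (n i : nat) : set R := `[node n i, node n i.+1[.
Definition ncells (n : nat) : nat := (2 * (n.+1 * n.+1))%N.
Definition node_of (n : nat) (t : R) : R :=
  node n (Num.truncn ((t + n.+1%:R) * n.+1%:R)).

Definition step (V : normedModType R[i]) (n : nat) (g : R -> V) (t : R) : V :=
  \sum_(i < ncells n) (\1_(cell n i) t)%:C *: g (node n i).

Definition riemann_sum (V : normedModType R[i]) (n : nat) (g : R -> V) : V :=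
  \sum_(i < ncells n) (n.+1%:R^-1)%:C *: g (node n i).

Lemma nodeS n i : node n i.+1 = node n i + n.+1%:R^-1.
Proof. by rewrite /node -[i.+1%:R]natr1 mulrDl mul1r addrA. Qed.

Lemma node_last n : node n (ncells n) = n.+1%:R.
Proof.
rewrite /node /ncells !natrM mulrA mulfK// mulr_natl mulr2n addKr//.
Qed.

Lemma step_simple (V : normedModType R[i]) n (g : R -> V) :
  simple_with_integral (step n g) (riemann_sum n g).
Proof.
exists (ncells n), (fun i : 'I_ _ => cell n i), (fun i : 'I_ _ => g (node n i)).
have mc i : mu (cell n i) = (n.+1%:R^-1)%:E.
  rewrite [LHS]lebesgue_measure_itv/= lte_fin nodeS ltrDl invr_gt0 ltr0n/=.
  by rewrite -EFinB addrAC subrr add0r.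
split=> // [i|]; last by apply: eq_bigr => i _; rewrite [lebesgue_measure _](mc i).
by split; [exact: measurable_itv|rewrite [lebesgue_measure _](mc i) ltry].
Qed.

Lemma node_of_near n t : - n.+1%:R <= t -> 0 <= t - node_of n t < n.+1%:R^-1.
Proof.
move=> nt; have d0 : 0 < n.+1%:R :> R by rewrite ltr0n.
have x0 : 0 <= (t + n.+1%:R) * n.+1%:R by rewrite mulr_ge0// -lerBlDr sub0r.
have /andP[] := truncn_itv x0; set k := Num.truncn _ => h1 h2.
rewrite /node_of -/k /node opprD opprK addrA subr_ge0 ltrBlDr.
rewrite ler_pdivrMr// h1/=.
by rewrite -[X in _ < X + _]mul1r -mulrDl [1 + _]addrC natr1 ltr_pdivlMr.
Qed.

Lemma step_in (V : normedModType R[i]) n (g : R -> V) t :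
  - n.+1%:R <= t < n.+1%:R -> step n g t = g (node_of n t).
Proof.
move=> /andP[nt tn]; have d0 : 0 < n.+1%:R :> R by rewrite ltr0n.
have x0 : 0 <= (t + n.+1%:R) * n.+1%:R by rewrite mulr_ge0// -lerBlDr sub0r.
have cellE i : (t \in cell n i) = (i == Num.truncn ((t + n.+1%:R) * n.+1%:R)).
  rewrite eq_sym truncn_eq// mem_setE in_itv /= /node.
  rewrite -lerBrDl opprK ler_pdivrMr//; congr (_ && _).
  by rewrite -ltrBlDl opprK ltr_pdivlMr.
have kn : (Num.truncn ((t + n.+1%:R) * n.+1%:R) < ncells n)%N.
  rewrite truncn_lt_nat// /ncells !natrM mulrA ltr_pM2r//.
  by rewrite mulr_natl mulr2n ltrD2r.
rewrite /step (bigD1 (Ordinal kn))//= big1 => [|i /negPf ik].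
  by rewrite addr0 indicE cellE eqxx scale1r.
by rewrite indicE cellE (_ : (_ == _) = false) ?scale0r.
Qed.


Lemma step_out (V : normedModType R[i]) n (g : R -> V) t :
  ~~ (- n.+1%:R <= t < n.+1%:R) -> step n g t = 0.
Proof.
move=> /negP nt; rewrite /step big1// => i _.
rewrite indicE (_ : (_ \in _) = false) ?scale0r//; apply/negP.
rewrite inE /cell /= in_itv/= => /andP[h1 h2]; apply: nt; apply/andP; split.
  by apply: le_trans h1; rewrite /node lerDl divr_ge0.
apply: (lt_le_trans h2); rewrite -(node_last n) /node lerD2l ler_pM2r ?invr_gt0 ?ltr0n//.
by rewrite ler_nat.
Qed.

(** Sampling at the left end of a cell moves the argument by less than 1, which costs the factor 3
    of [kappa_shift]. *)
Lemma step_kappa (V : normedModType R[i]) n (g : R -> V) (c : R) :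
  (forall t, rnorm (g t) <= c * kappa t) ->
  forall t, rnorm (step n g t) <= 3 * c * kappa t.
Proof.
move=> gk t.
have c0 : 0 <= c.
  by rewrite -(pmulr_lge0 _ (kappa_gt0 0)); apply: le_trans (gk 0); exact: rnorm_ge0.
have [|/step_out->] := boolP (- n.+1%:R <= t < n.+1%:R); last first.
  by rewrite rnorm0 !mulr_ge0// kappa_ge0.
move=> nt; rewrite step_in//; apply: (le_trans (gk _)).
rewrite [3 * c]mulrC -mulrA ler_wpM2l// kappa_shift//.
have /andP[/node_of_near/andP[h1 h2] _] := nt.
rewrite ger0_norm//; apply: (le_trans (ltW h2)).
by rewrite invf_le1// ?ltr0n// ler1n.
Qed.

Lemma step_cvg (V : normedModType R[i]) (g : R -> V) t :
  {for t, continuous g} -> step n g t @[n --> \oo] --> g t.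
Proof.
move=> /continuous_rnormP gc; apply/cvg_rnormP => e /gc[d d0 dh].
near=> n.
have dn : n.+1%:R^-1 < d by near: n; exact: near_infty_natSinv_lt (PosNum d0).
have tn : `|t| < n.+1%:R.
  near: n; exists (Num.truncn `|t|) => // n /= hn.
  by apply: lt_le_trans (truncnS_gt _) _; rewrite ler_nat ltnS.
have nt : - n.+1%:R <= t < n.+1%:R.
  by move: tn; rewrite ltr_norml => /andP[/ltW -> ->].
rewrite step_in// rnorm_distC -(subrKC t (node_of n t)); apply: dh.
have /andP[/node_of_near/andP[h1 h2] _] := nt.
by rewrite distrC ger0_norm// (lt_trans h2).
Unshelve. all: by end_near.
Qed.

Lemma step_dominated (V : normedModType R[i]) (g : R -> V) (c : R) :
  continuous g -> (forall t, rnorm (g t) <= c * kappa t) ->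
  (\int[mu]_t (rnorm (g t - step n g t))%:E)%E @[n --> \oo] --> 0%E.
Proof.
move=> gc gk.
have c0 : 0 <= c.
  by rewrite -(pmulr_lge0 _ (kappa_gt0 0)); apply: le_trans (gk 0); exact: rnorm_ge0.
have mg : strongly_measurable g.
  exists (fun n => step n g) => [n|t]; first by exists (riemann_sum n g); exact: step_simple.
  exact/step_cvg/gc.
apply: (@kappa_dominated _ _ (4 * c)) => [n|n t|t].
- exact: strongly_measurable_norm mg (step_simple n g).
- rewrite rnorm_ge0/=; apply: (le_trans (rnormB _ _)).
  rewrite (_ : 4 * c * _ = c * kappa t + 3 * c * kappa t); last by ring.
  by rewrite lerD// step_kappa.
have := step_cvg (gc t) => /cvg_rnormP h.
apply/cvgrPdist_lt => e /h; apply: filterS => n.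
by rewrite sub0r normrN /= ger0_norm// rnorm_ge0.
Qed.

End Riemann.

Section Bochner.
Variables (R : realType) (V : completeNormedModType R[i]).
Let mu := @lebesgue_measure R.

(** On this class the integral is the limit of [riemann_sum], so linearity and commutation with
    bounded operators follow from the same facts for finite sums. *)
Definition integrand (g : R -> V) : Prop :=
  continuous g /\ exists c, forall t, rnorm (g t) <= c * kappa t.

(** The step functions approximate [g] in the mean; by [simple_dist_le] the Riemann sums are Cauchy,
    and completeness of [V] supplies the value. *)
Lemma is_bochner_riemann (g : R -> V) : integrand g ->
  exists2 v, is_bochner_integral g v & riemann_sum n g @[n --> \oo] --> v.
Proof.
move=> [gc [c gk]].
have sm := @step_simple R V ^~ g.
have mg : strongly_measurable g.
  exists (fun n => step n g) => [n|t]; first by exists (riemann_sum n g).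
  exact/step_cvg/gc.
have s0 := step_dominated gc gk.
suff /cvg_ex[v Iv] : cvg (riemann_sum n g @[n --> \oo]).
  exists v => //; exists (fun n => step n g), (fun n => riemann_sum n g).
  by split => // t; exact/step_cvg/gc.
apply/cauchy_cvgP/cauchy_ballP => e e0.
pose r := complex.Re e.
have eE : e = r%:C by rewrite RRe_real// gtr0_real.
have r0 : 0 < r by rewrite -ltcR -eE.
have r20 : 0 < r / 2 by rewrite divr_gt0.
have h2 := ereal_cvg0_lt s0 r20.
rewrite near_map2; near=> x y; rewrite -ball_normE /ball_/= rnormE eE ltcR -lte_fin.
apply: (le_lt_trans (simple_dist_le mg (sm x) (sm y))).
rewrite (splitr r) EFinD lteD//.
  by near: x.
by near: y.
Unshelve. all: by end_near.
Qed.

Lemma bochnerP (g : R -> V) : integrand g ->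
  is_bochner_integral g (bochner_integral g).
Proof. by move=> /is_bochner_riemann[v gv _]; rewrite (bochner_integralE gv). Qed.

Lemma riemann_sum_cvg (g : R -> V) : integrand g ->
  riemann_sum n g @[n --> \oo] --> bochner_integral g.
Proof. by move=> /is_bochner_riemann[v gv]; rewrite (bochner_integralE gv). Qed.

Lemma bochner_le (g : R -> V) (c : R) : continuous g ->
  (forall t, rnorm (g t) <= c * kappa t) -> rnorm (bochner_integral g) <= c * pi.
Proof.
move=> gc gk; have ig : integrand g by split => //; exists c.
have := bochner_dist_le (bochnerP ig) (simple0 V); rewrite subr0 => h.
rewrite -lee_fin; apply: (le_trans h).
have c0 : 0 <= c.
  by rewrite -(pmulr_lge0 _ (kappa_gt0 0)); apply: le_trans (gk 0); exact: rnorm_ge0.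
apply: integral_kappa_le => // [|t]; last by rewrite subr0 rnorm_ge0 gk.
apply: strongly_measurable_norm (simple0 V).
exact: bochner_strongly_measurable (bochnerP ig).
Qed.

End Bochner.

(** * Bochner integral: linearity and integration of derivatives *)

Section BoundedOperators.
Variables (R : realType) (V : completeNormedModType R[i]).

Lemma linear_additive (T : V -> V) : linear T -> forall x y, T (x + y) = T x + T y.
Proof. by move=> lT x y; have := lT 1 x y; rewrite !scale1r. Qed.

Lemma linear_zero (T : V -> V) : linear T -> T 0 = 0.
Proof.
move=> lT; have := linear_additive lT 0 0; rewrite addr0 => /eqP.
by rewrite -subr_eq0 opprD addrA subrr sub0r oppr_eq0 => /eqP.
Qed.

Lemma linear_homogeneous (T : V -> V) : linear T ->
  forall a x, T (a *: x) = a *: T x.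
Proof. by move=> lT a x; rewrite -[a *: x]addr0 lT linear_zero// addr0. Qed.

Lemma linear_sub (T : V -> V) : linear T -> forall x y, T (x - y) = T x - T y.
Proof.
by move=> lT x y; rewrite linear_additive// -scaleN1r linear_homogeneous// scaleN1r.
Qed.

Lemma bounded_op_le (T : V -> V) : bounded_op T ->
  exists2 K : R, 0 <= K & forall x, rnorm (T x) <= K * rnorm x.
Proof.
move=> [lT Tfin].
have T0 := linear_zero lT.
have le1 x : rnorm x <= 1 -> ((rnorm (T x))%:E <= opnorm T)%E.
  by move=> x1; apply: ereal_sup_ubound; exists x.
have op0 : (0 <= opnorm T)%E.
  by apply: le_trans (le1 0 _); rewrite ?lee_fin ?rnorm_ge0// rnorm0.
have opfin : opnorm T \is a fin_num by rewrite ge0_fin_numE.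
exists (fine (opnorm T)) => [|x]; first exact: fine_ge0.
have [->|x0] := eqVneq x 0; first by rewrite T0 !rnorm0 mulr0.
have nx0 : 0 < rnorm x.
  rewrite lt_neqAle rnorm_ge0 andbT eq_sym.
  by apply: contra_neq x0; exact: rnorm_eq0.
have := le1 ((rnorm x)^-1%:C *: x).
rewrite rnormZr ger0_norm ?invr_ge0 ?rnorm_ge0// mulVf ?gt_eqF// lexx => /(_ erefl).
rewrite linear_homogeneous// rnormZr ger0_norm ?invr_ge0 ?rnorm_ge0//.
by rewrite -(fineK opfin) lee_fin mulrC ler_pdivrMr.
Qed.

Lemma bounded_op_continuous (T : V -> V) (K : R) (I : Type) (G : set_system I)
  (FG : Filter G) (u : I -> V) (l : V) : linear T ->
  (forall x, rnorm (T x) <= K * rnorm x) ->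
  u x @[x --> G] --> l -> T (u x) @[x --> G] --> T l.
Proof.
move=> lT TK /cvg_rnormP h; apply/cvg_rnormP => e e0.
have K0 : 0 < 1 + `|K| by rewrite ltr_pwDl.
have := h _ (divr_gt0 e0 K0); apply: filterS => x; rewrite ltr_pdivlMr// => xe.
rewrite -linear_sub//; apply: le_lt_trans (TK _) _; apply: le_lt_trans xe.
rewrite mulrC ler_wpM2l ?rnorm_ge0//.
by rewrite (le_trans (ler_norm _))// lerDr.
Qed.

End BoundedOperators.

Section BochnerTheory.
Variables (R : realType) (V : completeNormedModType R[i]).
Let mu := @lebesgue_measure R.

Lemma integrandD (g h : R -> V) : integrand g -> integrand h ->
  integrand (fun s => g s + h s).
Proof.
move=> [gc [c gk]] [hc [d hk]]; split.
  by move=> x; apply: cvgD; [exact: gc|exact: hc].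
by exists (c + d) => t; apply: le_trans (rnormD _ _) _; rewrite mulrDl lerD.
Qed.

Lemma integrand_op (T : V -> V) (K : R) (g : R -> V) : linear T ->
  0 <= K -> (forall x, rnorm (T x) <= K * rnorm x) ->
  integrand g -> integrand (T \o g).
Proof.
move=> lT K0 TK [gc [c gk]]; split.
  by move=> x; apply: (bounded_op_continuous _ lT TK); exact: gc.
exists (K * c) => t; apply: le_trans (TK _) _; rewrite -mulrA.
by rewrite ler_wpM2l.
Qed.

Lemma integrandZ (a : R[i]) (g : R -> V) : integrand g ->
  integrand (fun s => a *: g s).
Proof.
apply: (@integrand_op (fun x => a *: x) (rnorm a)); last 2 first.
- exact: rnorm_ge0.
- by move=> x; rewrite rnormZ.
by move=> b x y; rewrite scalerDr !scalerA mulrC.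
Qed.

Lemma integrand_sum (I : Type) (r : seq I) (g : I -> R -> V) :
  (forall i, integrand (g i)) -> integrand (fun s => \sum_(i <- r) g i s).
Proof.
move=> ig; elim: r => [|i r IH].
  under eq_fun do rewrite big_nil; split; first by move=> x; exact: cvg_cst.
  by exists 0 => t; rewrite rnorm0 mul0r.
by under eq_fun do rewrite big_cons; exact: integrandD.
Qed.

Lemma bochnerD (g h : R -> V) : integrand g -> integrand h ->
  bochner_integral (fun s => g s + h s) = bochner_integral g + bochner_integral h.
Proof.
move=> ig ih; have := riemann_sum_cvg (integrandD ig ih).
have c1 : (fun n => riemann_sum n g + riemann_sum n h) @ \oo -->
    bochner_integral g + bochner_integral h.
  by apply: cvgD; exact: riemann_sum_cvg.
rewrite (_ : (fun n => _ + _) = fun n => riemann_sum n (fun s => g s + h s)) in c1.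
  by move=> c2; exact: (cvg_unique _ c2 c1).
apply/funext => n; rewrite /riemann_sum -big_split /=.
by apply: eq_bigr => i _; rewrite scalerDr.
Qed.

Lemma bochner_op (T : V -> V) (K : R) (g : R -> V) : linear T ->
  0 <= K -> (forall x, rnorm (T x) <= K * rnorm x) -> integrand g ->
  bochner_integral (T \o g) = T (bochner_integral g).
Proof.
move=> lT K0 TK ig; have := riemann_sum_cvg (integrand_op lT K0 TK ig).
have c1 : (fun n => T (riemann_sum n g)) @ \oo --> T (bochner_integral g).
  exact: bounded_op_continuous lT TK (riemann_sum_cvg ig).
rewrite (_ : (fun n => _) = fun n => riemann_sum n (T \o g)) in c1.
  by move=> c2; exact: (cvg_unique _ c2 c1).
apply/funext => n; rewrite /riemann_sum.
elim/big_rec2: _ => [|i x y _ <-]; first exact: linear_zero.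
by rewrite linear_additive// linear_homogeneous.
Qed.

Lemma bochnerZ (a : R[i]) (g : R -> V) : integrand g ->
  bochner_integral (fun s => a *: g s) = a *: bochner_integral g.
Proof.
apply: (@bochner_op (fun x => a *: x) (rnorm a)); last 2 first.
- exact: rnorm_ge0.
- by move=> x; rewrite rnormZ.
by move=> b x y; rewrite scalerDr !scalerA mulrC.
Qed.

Lemma bochnerB (g h : R -> V) : integrand g -> integrand h ->
  bochner_integral (fun s => g s - h s) = bochner_integral g - bochner_integral h.
Proof.
move=> ig ih; rewrite -[- _]scaleN1r -(bochnerZ (-1) ih).
rewrite -(bochnerD ig (integrandZ (-1) ih)).
by congr bochner_integral; apply/funext => s; rewrite scaleN1r.
Qed.

Lemma bochner_sum (I : Type) (r : seq I) (g : I -> R -> V) :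
  (forall i, integrand (g i)) ->
  bochner_integral (fun s => \sum_(i <- r) g i s) =
  \sum_(i <- r) bochner_integral (g i).
Proof.
move=> ig; elim: r => [|i r IH].
  under eq_fun do rewrite big_nil.
  rewrite big_nil; apply: rnorm_eq0; apply/eqP; rewrite eq_le rnorm_ge0 andbT.
  rewrite -(mul0r pi); apply: bochner_le => [x|t]; first exact: cvg_cst.
  by rewrite rnorm0 mul0r.
under eq_fun do rewrite big_cons.
by rewrite bochnerD ?IH ?big_cons//; exact: integrand_sum.
Qed.

(** On [|s| <= r] one has [(1 + r^2) * kappa s >= 1]. *)
Lemma compact_support_kappa (g : R -> V) (M r : R) : 0 <= M ->
  (forall s, r < `|s| -> g s = 0) -> (forall s, rnorm (g s) <= M) ->
  forall s, rnorm (g s) <= M * (1 + r ^+ 2) * kappa s.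
Proof.
move=> M0 g0 gM s.
have [sr|/g0->] := leP `|s| r; last first.
  by rewrite rnorm0 !mulr_ge0 ?kappa_ge0 ?addr_ge0 ?sqr_ge0.
apply: le_trans (gM s) _; rewrite -mulrA ler_peMr//.
rewrite /kappa ler_pdivlMr ?ltr_pwDl ?sqr_ge0// mul1r lerD2l.
by rewrite -(real_normK (num_real s)) lerXn2r ?nnegrE// (le_trans _ sr).
Qed.

Lemma integrand_support (g : R -> V) (r : R) : continuous g ->
  (forall s, r < `|s| -> g s = 0) -> integrand g.
Proof.
move=> gc g0; split => //; have [M M0 gM] := continuous_bounded r gc.
exists (M * (1 + r ^+ 2)); apply: compact_support_kappa => // s.
by have [/gM//|/g0->] := leP `|s| r; rewrite rnorm0.
Qed.

(* With step 1/(n+1) the Riemann sums of the difference quotients of [G]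
   telescope to [G (n+1) - G (-n-1)]. *)
Lemma bochner_derivative (G G' : R -> V) (r : R) :
  (forall t, has_der G G' t) -> continuous G' ->
  (forall s, r < `|s| -> G s = 0) -> (forall s, r < `|s| -> G' s = 0) ->
  bochner_integral G' = 0.
Proof.
move=> dG cG' G0 G'0.
have [M M0 G'M'] := continuous_bounded r cG'.
have G'M s : rnorm (G' s) <= M.
  by have [/G'M'//|/G'0->] := leP `|s| r; rewrite rnorm0.
have iG' := integrand_support cG' G'0.
have cG t : {for t, continuous G} by exact: has_der_continuous (dG t).
pose d n : R := n.+1%:R.
have d0 n : 0 < d n by rewrite ltr0n.
(* The error of the difference quotient of step [1/(n+1)]. It is bounded by [2 * M] and vanishes
   beyond [r + 1], hence one multiple of [kappa] dominates it for all [n]. *)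
pose H n s := (d n)%:C *: (G (s + (d n)^-1) - G s) - G' s.
have tele n : riemann_sum n (fun s => (d n)%:C *: (G (s + (d n)^-1) - G s)) =
    G (d n) - G (- d n).
  rewrite /riemann_sum.
  under eq_bigr => i _ do rewrite scalerA -rmorphM mulVf ?gt_eqF// scale1r -nodeS.
  rewrite -(big_mkord xpredT (fun i => G (node R n i.+1) - G (node R n i))).
  by rewrite telescope_sumr// node_last /node mul0r addr0.
have Hbound n s : rnorm (H n s) <= 2 * M.
  apply: le_trans (rnormB _ _) _; rewrite mulr2n mulrDl mul1r lerD//.
  rewrite rnormZr gtr0_norm// mulrC -ler_pdivlMr//.
  have := @mean_value_le R V G G' s (s + (d n)^-1) M.
  rewrite addrAC subrr add0r; apply => //.
  by rewrite lerDl invr_ge0 ltW.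
have Hsupp n s : r + 1 < `|s| -> H n s = 0.
  move=> rs; rewrite /H (G0 s) ?(G'0 s) ?G0 ?subrr ?scaler0 ?subr0//.
  - have := ler_normB (s + (d n)^-1) (d n)^-1.
    have dV0 : 0 < (d n)^-1 by rewrite invr_gt0.
    rewrite addrK (gtr0_norm dV0).
    have : (d n)^-1 <= 1 by rewrite invf_le1// ler1n.
    move: rs; move: (`|s|) (`|_|) ((d n)^-1) => x y z; lra.
  - by apply: lt_trans rs; rewrite ltrDl.
  - by apply: lt_trans rs; rewrite ltrDl.
have Hk n := compact_support_kappa (mulr_ge0 (ler0n _ 2) M0) (Hsupp n) (Hbound n).
set c := 2 * M * _ in Hk.
(* The node where [H n] is evaluated moves with [n], so differentiability at one point is not
   enough: continuity of [G'] at [t] controls the quotient through the mean value inequality for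
   [z |-> G z - z G' t]. *)
have Hcvg t : rnorm (step n (H n) t) @[n --> \oo] --> (0 : R).
  apply/cvgrPdist_lt => e e0.
  have e40 : 0 < e / 4 by rewrite divr_gt0.
  have [a a0 ah] := (continuous_rnormP _ _).1 (cG' t) _ e40.
  near=> n; rewrite sub0r normrN ger0_norm ?rnorm_ge0//.
  have [|/step_out->] := boolP (- n.+1%:R <= t < n.+1%:R); last by rewrite rnorm0.
  move=> nt; rewrite step_in//.
  have /andP[/node_of_near/andP[h1 h2] _] := nt.
  have dn : (d n)^-1 < a.
    by near: n; exact: near_infty_natSinv_lt (PosNum a0).
  move: (node_of n t) h1 h2 => x h1 h2.
  have near z : x <= z <= x + (d n)^-1 -> rnorm (G' z - G' t) < e / 4.
    move=> /andP[xz zx]; rewrite -[z](subrKC t); apply: ah.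
    rewrite ltr_norml; apply/andP; move: h1 h2 dn xz zx.
    by rewrite -/(d n); move: ((d n)^-1) => y *; split; lra.
  have near_x : rnorm (G' x - G' t) < e / 4.
    by apply: near; rewrite lexx lerDl invr_ge0 ltW.
  rewrite /H (_ : _ - _ = (d n)%:C *: (G (x + (d n)^-1) - (x + (d n)^-1)%:C *: G' t -
    (G x - x%:C *: G' t)) - (G' x - G' t)); last first.
    rewrite rmorphD /= scalerDl.
    rewrite (_ : _ - _ - (G x - _) = G (x + (d n)^-1) - G x - ((d n)^-1)%:C *: G' t).
      rewrite [in RHS]scalerBr scalerA -rmorphM divff ?gt_eqF// scale1r.
      by rewrite opprB [in RHS]addrA subrK.
    by rewrite !opprD opprK [LHS](AC (1*2*2) (1*4*3*(5*2)))/= subrr addr0.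
  apply: le_lt_trans (rnormB _ _) _.
  apply: (@le_lt_trans _ _ (e / 4 + e / 4)); last by lra.
  apply: lerD; last exact: ltW.
  rewrite rnormZr gtr0_norm// mulrC -ler_pdivlMr//.
  have := @mean_value_le R V (fun z => G z - z%:C *: G' t) (fun z => G' z - G' t)
    x (x + (d n)^-1) (e / 4).
  rewrite [x + _ - x]addrAC subrr add0r; apply => //.
  - by rewrite lerDl invr_ge0 ltW.
  - by move=> z _; apply: has_derB (dG z) (has_der_linear _ _).
  - by move=> z /near/ltW.
have I0 := kappa_dominated (fun n => simple_measurable_norm (step_simple n (H n)))
  _ Hcvg (c := 3 * c).
have {}I0 : (\int[mu]_t (rnorm (step n (H n) t))%:E)%E @[n --> \oo] --> 0%E.
  by apply: I0 => n t; rewrite rnorm_ge0 step_kappa.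
suff : riemann_sum n G' @[n --> \oo] --> (0 : V).
  by move=> h; apply: (cvg_unique _ (riemann_sum_cvg iG') h).
apply/cvg_rnormP => e /(ereal_cvg0_lt I0) In.
near=> n; rewrite sub0r rnormN -lte_fin.
(* Once [n + 1 > r], both end values of [G] vanish: the quotients sum to 0 and only their errors
   remain. *)
have -> : riemann_sum n G' = - riemann_sum n (H n).
  have rn : r < d n.
    near: n; exists (Num.truncn r) => // n /= hn.
    by apply: lt_le_trans (truncnS_gt _) _; rewrite ler_nat ltnS.
  have := tele n; rewrite !G0 ?normrN ?gtr0_norm// subrr => tele0.
  rewrite -[RHS]add0r -tele0 /riemann_sum -sumrN -big_split/=.
  by apply: eq_bigr => i _; rewrite -scalerBr /H opprB addrC subrK.
rewrite rnormN; apply: (le_lt_trans (simple_norm_integral (step_simple n (H n)))).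
by near: n.
Unshelve. all: by end_near.
Qed.

End BochnerTheory.

(** * A band-limited function *)

Section Sinc.
Variable R : realType.
Let mu := @lebesgue_measure R.

Fixpoint dsin (k : nat) (x : R) : R :=
  match k with 0 => sin x | 1 => cos x | k'.+2 => - dsin k' x end.

Lemma dsin_derive k x : is_derive x (1 : R) (dsin k) (dsin k.+1 x).
Proof.
elim/ltn_ind: k x => -[|[|k]] IH x /=.
- exact: is_derive_sin.
- exact: is_derive_cos.
- by apply: is_deriveN; apply: IH; rewrite ltnS leqnSn.
Qed.

Lemma dsin_le1 k x : `|dsin k x| <= 1.
Proof.
elim/ltn_ind: k x => -[|[|k]] IH x /=; rewrite ?normrN.
- by rewrite ler_norml sin_geN1 sin_le1.
- by rewrite ler_norml cos_geN1 cos_le1.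
- by apply: IH; rewrite ltnS leqnSn.
Qed.

Arguments dsin : simpl never.

Lemma is_derive_continuous (f : R -> R) (df x : R) :
  is_derive x (1 : R) f df -> {for x, continuous f}.
Proof. by move=> [/derivable1_diffP/differentiable_continuous]. Qed.

Lemma continuous_dsin k : continuous (dsin k).
Proof. by move=> x; exact: is_derive_continuous (dsin_derive k x). Qed.

(* The [k]-th derivative of [sin t / t], written as the [k]-th [t]-derivative
   of the integral of [cos (t s)] over [0 <= s <= 1]. *)
Definition sinc (k : nat) (t : R) : R :=
  \int[mu]_(s in `[0, 1]) (s ^+ k * dsin k.+1 (t * s)).

Let kernel_continuous k t : continuous (fun s : R => s ^+ k * dsin k.+1 (t * s)).
Proof.
move=> s; apply: cvgM; first exact: exprn_continuous.
apply: (cvg_comp (fun s => t * s) (dsin k.+1)); last exact: continuous_dsin.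
by apply: cvgM; [exact: cvg_cst|exact: cvg_id].
Qed.

Let integrable01 (f : R -> R) : continuous f ->
  mu.-integrable `[0, 1] (EFin \o f).
Proof.
move=> cf; apply: continuous_compact_integrable; first exact: segment_compact.
exact: continuous_subspaceT.
Qed.

Let kernel_le k (t s : R) : s \in `[0, 1] -> `|s ^+ k * dsin k.+1 (t * s)| <= 1.
Proof.
rewrite in_itv/= => /andP[s0 s1]; rewrite normrM -[leRHS]mulr1.
apply: ler_pM => //; last exact: dsin_le1.
by rewrite ger0_norm ?exprn_ge0// exprn_ile1.
Qed.

Let kernel_derive k (s t : R) :
  is_derive t (1 : R) (fun t => s ^+ k * dsin k.+1 (t * s))
    (s ^+ k.+1 * dsin k.+2 (t * s)).
Proof.
have d1 : is_derive t (1 : R) (fun t : R => t * s) s.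
  have := is_deriveM (is_derive_id t (1 : R)) (is_derive_cst s t (1 : R)).
  by rewrite scaler0 add0r /GRing.scale/= mulr1.
have d2 := @is_derive1_comp R (dsin k.+1) (fun t => t * s) _ _ _ (dsin_derive k.+1 (t * s)) d1.
have := is_deriveM (is_derive_cst (s ^+ k) t (1 : R)) d2.
rewrite scaler0 addr0 /GRing.scale/= => h.
rewrite (_ : s ^+ k.+1 * _ = s ^+ k * (dsin k.+2 (t * s) * s))//.
by rewrite exprS; ring.
Qed.

(** Differentiation under the integral sign. The derivative of the integrand is the next integrand,
    bounded by 1 for every [t], so any neighbourhood of [t] serves. *)
Lemma sinc_derive k t : is_derive t (1 : R) (sinc k) (sinc k.+1 t).
Proof.
pose f (t s : R) := s ^+ k * dsin k.+1 (t * s).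
have tI : `]t - 1, t + 1[%classic t.
  by rewrite /= in_itv/=; apply/andP; split; lra.
have p1 x y : partial1of2 f x y = y ^+ k.+1 * dsin k.+2 (x * y).
  by rewrite partial1of2E; have [_ ->] := kernel_derive k y x.
have i1 x : `]t - 1, t + 1[%classic x -> mu.-integrable `[0, 1] (EFin \o f x).
  by move=> _; apply: integrable01; exact: kernel_continuous.
have d1 x y : `]t - 1, t + 1[%classic x -> `[0, 1]%classic y -> derivable (f^~ y) x 1.
  by move=> _ _; have [] := kernel_derive k y x.
have iG : mu.-integrable `[0, 1] (EFin \o cst (1 : R)).
  by apply: integrable01; exact: cst_continuous.
have bd x y : `]t - 1, t + 1[%classic x -> `[0, 1]%classic y ->
    `|partial1of2 f x y| <= cst 1 y.
  by move=> _ y01; rewrite p1; exact: kernel_le.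
have mI : measurable (`[0, 1]%classic : set (measurableTypeR R)).
  exact: measurable_itv.
apply: DeriveDef.
  exact: (@derivable_under_integral R _ _ mu f _ mI _ _ _ tI i1 d1 _ (fun=> ler01) iG bd).
rewrite -derive1E.
rewrite (@differentiation_under_integral R _ _ mu f _ mI _ _ _ tI i1 d1 _ (fun=> ler01) iG bd).
by rewrite /sinc; apply: eq_Rintegral => y _; rewrite p1.
Qed.

Lemma sinc_le1 k t : `|sinc k t| <= 1.
Proof.
have ck := @kernel_continuous k t.
apply: le_trans (le_normr_Rintegral _ _) _ => //; first exact: integrable01.
apply: (@le_trans _ _ (\int[mu]_(s in `[0, 1]) cst 1 s)); last first.
  rewrite Rintegral_cst// [X in fine X](lebesgue_measure_itv `[0, 1])/=.
  by rewrite lte_fin ltr01 -EFinB subr0 mulr1.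
apply: le_Rintegral => //; last exact: kernel_le.
- by apply: integrable01 => x; apply: cvg_norm; exact: ck.
- by apply: integrable01; exact: cst_continuous.
Qed.

(** Fundamental theorem of calculus for [s |-> sin (t * s)] on the unit interval; this form includes
    [t = 0]. *)
Lemma sinc0_mul t : t * sinc 0 t = sin t.
Proof.
have d0 s : is_derive s (1 : R) (fun s => sin (t * s)) (t * cos (t * s)).
  have d1 : is_derive s (1 : R) (fun s : R => t * s) t.
    have := is_deriveM (is_derive_cst t s (1 : R)) (is_derive_id s (1 : R)).
    by rewrite scaler0 addr0 /GRing.scale/= mulr1.
  have := @is_derive1_comp R sin (fun s => t * s) _ _ _ (is_derive_sin (t * s)) d1.
  by rewrite mulrC.
have cf : continuous (fun s => t * cos (t * s)).
  move=> s; apply: cvgM; first exact: cvg_cst.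
  apply: (cvg_comp (fun s => t * s) cos); last exact: continuous_cos.
  by apply: cvgM; [exact: cvg_cst|exact: cvg_id].
have cF s : {for s, continuous (fun s => sin (t * s))}.
  exact: is_derive_continuous (d0 s).
have := @continuous_FTC2 R (fun s => t * cos (t * s)) (fun s => sin (t * s)) 0 1 ltr01.
rewrite mulr1 mulr0 sin0 -EFinB subr0 => FTC.
rewrite /sinc -RintegralZl//; last exact: integrable01 (@kernel_continuous 0 t).
rewrite /Rintegral.
under eq_integral do rewrite expr0 mul1r /=.
rewrite FTC//.
- exact: continuous_subspaceT.
- split.
  + by move=> x _; have [] := d0 x.
  + by apply: cvg_at_right_filter; exact: cF.
  + by apply: cvg_at_left_filter; exact: cF.
- by move=> x _; rewrite derive1E; have [_ ->] := d0 x.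
Qed.

(** The [k]-th derivative of [t * sinc 0 t = sin t] by the Leibniz rule. For [k = 0] the coefficient
    [k%:R] removes the spurious term with index [k.-1]. *)
Lemma sinc_mul k t : t * sinc k t + k%:R * sinc k.-1 t = dsin k t.
Proof.
elim: k t => [|k IH] t; first by rewrite mul0r addr0 sinc0_mul.
have dt j : is_derive t (1 : R) (fun t : R => t * sinc j t) (sinc j t + t * sinc j.+1 t).
  have := is_deriveM (is_derive_id t (1 : R)) (sinc_derive j t).
  by rewrite /GRing.scale/= mulr1 addrC.
have dc j (c : R) : is_derive t (1 : R) (fun t => c * sinc j t) (c * sinc j.+1 t).
  have := is_deriveM (is_derive_cst c t (1 : R)) (sinc_derive j t).
  by rewrite scaler0 addr0.
have [_ <-] := dsin_derive k t.
rewrite (_ : dsin k = fun t => t * sinc k t + k%:R * sinc k.-1 t); last first.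
  by apply/funext => x; rewrite IH.
have [_ ->] := is_deriveD (dt k) (dc k.-1 k%:R).
case: k {IH} => [|k] /=; first by rewrite mul0r addr0 mul1r addrC.
by rewrite -[k.+2%:R]natr1; ring.
Qed.

(** By [sinc_mul], [|t * sinc k t| <= 1 + k <= 2^k], and [|sinc k t| <= 1]. The bound is made
    geometric in [k] so that it can be multiplied by [mulF_bound]. *)
Lemma sinc_decay k t : `|sinc k t| <= 2 * 2 ^+ k / (1 + `|t|).
Proof.
rewrite ler_pdivlMr ?ltr_pwDl// mulrDr mulr1 -normrM [sinc k t * t]mulrC.
have k2 : 1 + k%:R <= 2 ^+ k :> R.
  by rewrite -natrX addrC natr1 ler_nat; exact: ltn_expl.
have k1 : 0 <= k%:R :> R by [].
have -> : t * sinc k t = dsin k t - k%:R * sinc k.-1 t by rewrite -sinc_mul addrK.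
have h : `|dsin k t - k%:R * sinc k.-1 t| <= 1 + k%:R.
  apply: le_trans (ler_normB _ _) _; apply: lerD; first exact: dsin_le1.
  by rewrite normrM normr_nat ler_piMr// sinc_le1.
have := sinc_le1 k t; lra.
Qed.

Lemma sinc00 : sinc 0 0 = 1.
Proof.
rewrite /sinc (_ : (fun s => _) = cst 1); last first.
  by apply/funext => s; rewrite expr0 mul1r mul0r -[LHS]/(cos 0) cos0.
rewrite Rintegral_cst// [X in fine X](lebesgue_measure_itv `[0, 1])/=.
by rewrite lte_fin ltr01 -EFinB subr0 mulr1.
Qed.

End Sinc.

(** * Leibniz products and cutoffs *)

Section Families.
Variable R : realType.

Notation cder f f' t := (has_der (f : R -> R[i]^o) f' t).

(* [mulF k f g] is the [k]-th derivative of the product when [f] and [g] list the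
   successive derivatives of the factors (the Leibniz rule without binomials). *)
Fixpoint mulF (k : nat) (f g : nat -> R -> R[i]) : R -> R[i] :=
  match k with
  | 0 => fun t => f 0%N t * g 0%N t
  | k'.+1 => fun t => mulF k' (f \o succn) g t + mulF k' f (g \o succn) t
  end.

(** The order is limited to [m] for the sake of the cutoffs, which come with [m] derivatives
    only. *)
Lemma mulF_der m f g :
  (forall j t, (j < m)%N -> cder (f j) (f j.+1) t) ->
  (forall j t, (j < m)%N -> cder (g j) (g j.+1) t) ->
  forall k t, (k < m)%N -> cder (mulF k f g) (mulF k.+1 f g) t.
Proof.
move=> + + k; elim: k m f g => [|k IH] m f g df dg t km /=.
  exact: (has_derM (df 0%N t km) (dg 0%N t km)).
have [m' mE] : exists m', m = m'.+1 by case: m km {df dg} => // m' _; exists m'.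
move: df dg km; rewrite mE ltnS => df dg km.
apply: has_derD; apply: (IH m') => // j s jm.
- exact: df.
- by apply: dg; rewrite ltnW.
- by apply: df; rewrite ltnW.
- exact: dg.
Qed.

Lemma mulF_continuous k f g :
  (forall j, (j <= k)%N -> continuous (f j : R -> R[i]^o)) ->
  (forall j, (j <= k)%N -> continuous (g j : R -> R[i]^o)) ->
  continuous (mulF k f g : R -> R[i]^o).
Proof.
elim: k f g => [|k IH] f g cf cg x /=.
  exact: (@cvgM R[i] R (nbhs x) _ (f 0%N) (g 0%N) _ _ (cf 0%N isT x) (cg 0%N isT x)).
apply: cvgD; apply: IH => j jk; [exact: cf|apply: cg|apply: cf|exact: cg];
  exact: leqW.
Qed.

(** Bandwidths add under multiplication: ratios [a] and [b] give [a + b], each differentiation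
    falling on one factor or the other. *)
Lemma mulF_bound (f g : nat -> R -> R[i]) (t A a B b : R) :
  0 <= A -> 0 <= a -> 0 <= B -> 0 <= b ->
  (forall j, rnorm (f j t) <= A * a ^+ j) ->
  (forall j, rnorm (g j t) <= B * b ^+ j) ->
  forall k, rnorm (mulF k f g t) <= A * B * (a + b) ^+ k.
Proof.
move=> + a0 + b0 + + k; elim: k f g A B => [|k IH] f g A B A0 B0 fA gB /=.
  rewrite rnormM expr0 mulr1; apply: ler_pM; rewrite ?rnorm_ge0//.
    by have := fA 0%N; rewrite expr0 mulr1.
  by have := gB 0%N; rewrite expr0 mulr1.
apply: le_trans (rnormD _ _) _.
have h1 := IH (f \o succn) g (A * a) B (mulr_ge0 A0 a0) B0.
have h2 := IH f (g \o succn) A (B * b) A0 (mulr_ge0 B0 b0).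
apply: le_trans (lerD (h1 _ gB) (h2 fA _)) _ => [j|j|] /=.
- by rewrite -mulrA -exprS; exact: fA.
- by rewrite -mulrA -exprS; exact: gB.
- by rewrite exprS le_eqVlt; apply/orP; left; apply/eqP; ring.
Qed.

Lemma mulF_zero (f g : nat -> R -> R[i]) t k :
  (forall j, (j <= k)%N -> g j t = 0) -> mulF k f g t = 0.
Proof.
elim: k f g => [|k IH] f g g0 /=; first by rewrite g0// mulr0.
rewrite !IH ?addr0// => j jk /=; [exact: g0|]; apply: g0; exact: leqW.
Qed.

Lemma mulF_small (f g : nat -> R -> R[i]) (t A c : R) k : 0 <= A -> 0 <= c ->
  (forall j, (j <= k)%N -> rnorm (f j t) <= A) ->
  (forall j, (j <= k)%N -> rnorm (g j t) <= c) ->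
  rnorm (mulF k f g t) <= 2 ^+ k * (A * c).
Proof.
move=> A0 c0; elim: k f g => [|k IH] f g fA gc /=.
  by rewrite expr0 mul1r rnormM ler_pM ?rnorm_ge0 ?fA ?gc.
apply: le_trans (rnormD _ _) _.
rewrite exprS -mulrA mulr2n mulrDl mul1r lerD//.
  by apply: IH => j jk; [exact: fA|apply: gc; exact: leqW].
by apply: IH => j jk; [apply: fA; exact: leqW|exact: gc].
Qed.

(** Among the [2 ^+ k] Leibniz products only one has [g] undifferentiated; it is close to [f k]
    because [g 0] is close to 1, and in the others a derivative of [g] is small. *)
Lemma mulF_cutoff (f g : nat -> R -> R[i]) (t A c : R) k : 0 <= A -> 0 <= c ->
  (forall j, (j <= k)%N -> rnorm (f j t) <= A) ->
  (forall j, (0 < j <= k)%N -> rnorm (g j t) <= c) ->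
  rnorm (g 0%N t - 1) <= c ->
  rnorm (mulF k f g t - f k t) <= 2 ^+ k * (A * c).
Proof.
move=> A0 c0; elim: k f => [|k IH] f fA gc gc0 /=.
  by rewrite expr0 mul1r -{2}[f 0%N t]mulr1 -mulrBr rnormM ler_pM ?rnorm_ge0 ?fA.
rewrite -/(f k.+1 t) addrAC; apply: le_trans (rnormD _ _) _.
rewrite exprS -mulrA mulr2n mulrDl mul1r lerD//.
  apply: (IH (f \o succn)) => // [j jk|j /andP[j0 jk]]; first exact: fA.
  by apply: gc; rewrite j0 leqW.
apply: mulF_small => // j jk; first by apply: fA; exact: leqW.
by apply: gc.
Qed.

Lemma horner_has_der (p : {poly R}) t :
  cder (fun s => (p.[s])%:C) (fun s => (p^`().[s])%:C) t.
Proof.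
elim/poly_ind: p => [|p c IH].
  have := has_der_cst (0 : R[i]^o) t; congr has_der; apply/funext => s.
    by rewrite horner0.
  by rewrite deriv0 horner0.
have := has_derD (has_derM IH (has_der_linear (1 : R[i]^o) t))
  (has_der_cst (c%:C : R[i]^o) t).
congr has_der; apply/funext => s.
  by rewrite hornerMXaddC rmorphD rmorphM /= /GRing.scale/= mulr1.
rewrite derivMXaddC hornerD hornerMX rmorphD rmorphM /= /GRing.scale/= mulr1 addr0.
by rewrite mulr1 addrC.
Qed.

Definition truncate (V : normedModType R[i]) (u : R -> V) (s : R) : V :=
  if `|s| <= 1 then u s else 0.

Lemma truncate_near_in (V : normedModType R[i]) (u : R -> V) t h :
  `|t| < 1 -> `|h| < 1 - `|t| -> truncate u (t + h) = u (t + h).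
Proof.
move=> t1 h1; rewrite /truncate ifT//.
by apply: le_trans (ler_normD _ _) _; lra.
Qed.

Lemma truncate_near_out (V : normedModType R[i]) (u : R -> V) t h :
  1 < `|t| -> `|h| < `|t| - 1 -> truncate u (t + h) = 0.
Proof.
move=> t1 h1; rewrite /truncate ifF//; apply/negP => th.
by have := ler_normB (t + h) h; rewrite addrK; lra.
Qed.

Lemma truncate_le (V : normedModType R[i]) (u : R -> V) s :
  rnorm (truncate u s) <= rnorm (u s).
Proof. by rewrite /truncate; case: ifP => // _; rewrite rnorm0 rnorm_ge0. Qed.

(** Off [|t| = 1] the truncation is locally [u] or 0. At [|t| = 1] both [u] and [u'] vanish and
    truncation does not increase norms, so the remainder estimate of [u] is inherited. *)
Lemma truncate_has_der (V : normedModType R[i]) (u u' : R -> V) :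
  (forall t, has_der u u' t) -> (forall t, `|t| = 1 -> u t = 0 /\ u' t = 0) ->
  forall t, has_der (truncate u) (truncate u') t.
Proof.
move=> du u1 t e e0; have [d d0 dh] := du t e e0.
have [t1|t1|t1] := ltgtP `|t| 1.
- exists (Num.min d (1 - `|t|)); first by rewrite lt_min d0 subr_gt0.
  move=> h; rewrite lt_min => /andP[hd ht].
  rewrite truncate_near_in//.
  have tr (v : R -> V) : truncate v t = v t by rewrite /truncate ltW.
  by rewrite !tr dh.
- exists (`|t| - 1); first by rewrite subr_gt0.
  move=> h ht; rewrite truncate_near_out//.
  have tr (v : R -> V) : truncate v t = 0 by rewrite /truncate leNgt t1.
  by rewrite !tr scaler0 !subr0 rnorm0 mulr_ge0// ltW.
- exists d => // h /dh; have [ut u't] := u1 _ t1.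
  have tr (v : R -> V) : v t = 0 -> truncate v t = 0.
    by rewrite /truncate; case: ifP.
  rewrite !tr// ut u't scaler0 !subr0; apply: le_trans; exact: truncate_le.
Qed.

Lemma truncate_continuous (V : normedModType R[i]) (u : R -> V) :
  continuous u -> (forall t, `|t| = 1 -> u t = 0) -> continuous (truncate u).
Proof.
move=> cu u1 t; apply/continuous_rnormP => e e0.
have [d d0 dh] := (continuous_rnormP u t).1 (cu t) e e0.
have [t1|t1|t1] := ltgtP `|t| 1.
- exists (Num.min d (1 - `|t|)); first by rewrite lt_min d0 subr_gt0.
  move=> h; rewrite lt_min => /andP[hd ht].
  rewrite truncate_near_in//.
  by rewrite [truncate u t]/truncate ltW// dh.
- exists (`|t| - 1); first by rewrite subr_gt0.
  move=> h ht; rewrite truncate_near_out//.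
  by rewrite /truncate leNgt t1 subr0 rnorm0.
- exists d => // h /dh; have ut := u1 _ t1.
  have tr : truncate u t = 0 by rewrite /truncate; case: ifP.
  by rewrite tr ut !subr0; apply: le_lt_trans; exact: truncate_le.
Qed.

(** Each differentiation lowers the power of [v] by at most one, so the derivatives of order below
    [m] vanish at the roots of [v]. *)
Lemma derivn_power_factor (v : {poly R}) (m l : nat) : (l <= m)%N ->
  exists u, (v ^+ m)^`(l) = u * v ^+ (m - l).
Proof.
elim: l => [|l IH] lm; first by exists 1; rewrite derivn0 subn0 mul1r.
have [u uE] := IH (ltnW lm).
rewrite derivnS uE derivM deriv_exp subnS.
have : (0 < m - l)%N by rewrite subn_gt0.
case: (m - l)%N => // k _ /=.
exists (u^`() * v + u * v^`() *+ k.+1).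
by rewrite mulrDl exprS mulrA -mulrnAr mulrA mulrnAl mulrnAr.
Qed.

(** The function is [(1 - s^2)^(m+2)] cut off at [|s| = 1]: the exponent makes all derivatives up to
    order [m + 1] vanish at the end points. The last estimate is the mean value inequality from 0,
    where the value is 1. *)
Lemma cutoff_exists (m : nat) : exists (eta : nat -> R -> R[i]) (M : R),
  0 <= M /\ [/\ forall l, (l <= m)%N -> continuous (eta l : R -> R[i]^o),
     forall l t, (l < m)%N -> cder (eta l) (eta l.+1) t,
     forall l s, (l <= m)%N -> rnorm (eta l s) <= M,
     forall l s, (l <= m)%N -> 1 < `|s| -> eta l s = 0 &
     forall s, rnorm (eta 0%N s - 1) <= M * `|s|].
Proof.
pose v : {poly R} := 1 - 'X^2.
pose p l : {poly R} := (v ^+ m.+2)^`(l).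
pose q l (s : R) : R[i]^o := ((p l).[s])%:C.
have dq l t : has_der (q l) (q l.+1) t.
  by have := horner_has_der (p l) t; rewrite /q /p derivnS.
have cq l : continuous (q l) by move=> t; exact: has_der_continuous (dq l t).
have q1 l t : (l <= m.+1)%N -> `|t| = 1 -> q l t = 0.
  move=> lm t1; rewrite /q /p.
  have [u ->] := @derivn_power_factor v m.+2 l (leqW lm).
  rewrite hornerM horner_exp (_ : v.[t] = 0).
    by rewrite expr0n subn_eq0 leqNgt ltnS lm mulr0.
  by rewrite !hornerE -(real_normK (num_real t)) t1 expr1n subrr.
pose eta l s := truncate (q l) s.
have bounded n : exists M : R, 0 <= M /\
    forall l s, (l <= n)%N -> rnorm (eta l s) <= M.
  elim: n => [|k [M [M0 IH]]].
    have [M M0 qM] := continuous_bounded 1 (cq 0%N); exists M; split => // l s.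
    rewrite leqn0 => /eqP ->; rewrite /eta /truncate.
    by case: ifP => [/qM//|_]; rewrite rnorm0.
  have [M' M'0 qM'] := continuous_bounded 1 (cq k.+1).
  exists (Num.max M M'); split=> [|l s]; first by rewrite le_max M0.
  rewrite leq_eqVlt => /orP[/eqP ->|]; last first.
    by rewrite ltnS => /IH/le_trans; apply; rewrite le_max lexx.
  rewrite le_max /eta /truncate; apply/orP; right.
  by case: ifP => [/qM'//|_]; rewrite rnorm0.
(* Order [m + 1] is included so that [eta 1] is bounded even for [m = 0]. *)
have [M [M0 etaM]] := bounded m.+1.
have deta l t : (l < m.+1)%N -> cder (eta l) (eta l.+1) t.
  move=> lm; apply: truncate_has_der => // s s1.
  by split; apply: q1 => //; exact: ltnW.
exists eta, M; split => //; split.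
- by move=> l lm; apply: truncate_continuous => // t; apply: q1; exact: leqW.
- by move=> l t lm; apply: deta; exact: leqW.
- by move=> l s lm; apply: etaM; exact: leqW.
- by move=> l s _ s1; rewrite /eta /truncate leNgt s1.
- move=> s.
  have eta0 : eta 0%N 0 = 1.
    rewrite /eta /truncate normr0 ler01 /q /p derivn0 horner_exp !hornerE.
    by rewrite expr0n subr0 expr1n.
  have hb t : rnorm (eta 1%N t) <= M by exact: etaM.
  have [s0|s0] := leP 0 s.
    have := @mean_value_le R R[i]^o (eta 0%N) (eta 1%N) 0 s M s0.
    rewrite eta0 subr0 (ger0_norm s0); apply => t _; [exact: deta|exact: hb].
  have := @mean_value_le R R[i]^o (eta 0%N) (eta 1%N) s 0 M (ltW s0).
  rewrite eta0 sub0r (ltr0_norm s0) rnorm_distC; apply => t _; [exact: deta|exact: hb].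
Qed.

End Families.

(** * Weights and convolutions *)

Section Weight.
Variables (R : realType) (w : R -> R).

Lemma weight_gt0 : is_weight w -> forall t, 0 < w t.
Proof. by move=> hw t; apply: lt_le_trans (weight_ge1 hw t). Qed.

(** The growth condition with [t = 1] and [e = 1] speaks of large integers only. For real [x] with
    integer part [k], submultiplicativity bounds [w x] by [w k] times the maximum [K] of [w] on a
    compact interval; the factor 2 absorbs the 1 in [1 + k^(N+1)]. *)
Lemma weight_growth : is_weight w -> polynomial_growth w ->
  exists (N : nat) (W : R), forall t, w t <= W * (1 + `|t|) ^+ N.
Proof.
move=> hw [N [hN _]]; have [M hM] := hN 1 1 ltr01.
have w0 := weight_gt0 hw.
have wc : continuous w := weight_continuous hw.
have [||c _ hc] := @EVT_max R w (- M.+1%:R) M.+1%:R.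
- by rewrite ge0_cp.
- exact: continuous_subspaceT.
pose K := w c; have K1 : 1 <= K := weight_ge1 hw c.
have K0 : 0 <= K by apply: le_trans K1.
have hK t : `|t| <= M.+1%:R -> w t <= K.
  by move=> tM; apply: hc; rewrite in_itv/= -ler_norml.
exists N.+1, (2 * K) => t.
have P1 : 1 <= (1 + `|t|) ^+ N.+1 by rewrite exprn_ege1// lerDl.
have [tM|tM] := leP `|t| M.+1%:R.
  by apply: le_trans (hK _ tM) _; nra.
have -> : w t = w `|t| by have [_|_] := ger0P t; rewrite ?(weight_even hw).
set x := `|t| in P1 tM *; have x0 : 0 <= x by exact: normr_ge0.
pose k := Num.truncn x.
have /andP[kx xk] := truncn_itv x0; rewrite -/k in kx xk.
have Mk : (M <= k)%N.
  by rewrite -ltnS -(ltr_nat R); apply: lt_trans xk; apply: lt_trans tM; rewrite ltr_nat.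
have := hM k Mk; rewrite mulr1 -[k%:~R]/(k%:R) normr_nat => wk.
have d0 : 0 < 1 + k%:R ^+ N.+1 :> R by rewrite ltr_pwDl// exprn_ge0.
have {}wk : w k%:R <= 1 + k%:R ^+ N.+1.
  rewrite -[leRHS]mul1r -ler_pdivrMr//; apply: le_trans (ltW wk); exact: ler_norm.
have -> : w x = w (k%:R + (x - k%:R)) by rewrite subrKC.
apply: le_trans (weight_submul hw _ _) _.
have wxk : w (x - k%:R) <= K.
  apply: hK; rewrite ger0_norm ?subr_ge0// lerBlDr (le_trans (ltW xk))//.
  by rewrite -natr1 addrC lerD2r ler1n.
apply: le_trans (ler_pM (ltW (w0 _)) (ltW (w0 _)) wk wxk) _.
have kP : k%:R ^+ N.+1 <= (1 + x) ^+ N.+1.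
  by rewrite lerXn2r ?nnegrE// ?addr_ge0// (le_trans kx)// lerDr.
by move: kP P1; move: (_ ^+ _) (_ ^+ _) => a p; nra.
Qed.


Lemma ereal_sup_real_le (I : Type) (A : set I) (f : I -> R) (c : R) :
  (ereal_sup [set (f t)%:E | t in A] <= c%:E)%E <-> forall t, A t -> f t <= c.
Proof.
split=> [h t At|h].
  rewrite -lee_fin; apply: (le_trans _ h); apply: ereal_sup_ubound.
  by exists t.
by apply: ge_ereal_sup => _ [t At <-]; rewrite lee_fin h.
Qed.

Lemma ereal_cvg0P (T : Type) (G : set_system T) {FG : Filter G} (f : T -> \bar R) :
  (forall x, (0 <= f x)%E) ->
  f x @[x --> G] --> 0%E <->
  forall e : R, 0 < e -> \forall x \near G, (f x <= e%:E)%E.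
Proof.
move=> f0; split=> [/fine_cvgP[fin /cvgrPdist_lt fine_lt] e e0|h].
  have {}fine_lt := fine_lt _ e0.
  near=> x; have fx : f x \is a fin_num by near: x.
  have : `|0 - fine (f x)| < e by near: x.
  rewrite sub0r normrN => h; rewrite -(fineK fx) lee_fin.
  by rewrite (le_trans (ler_norm _))// ltW.
apply/fine_cvgP; split.
  have h1 := h 1 ltr01; near=> x.
  have fx1 : (f x <= 1%:E)%E by near: x.
  by rewrite ge0_fin_numE// (le_lt_trans fx1)// ltry.
apply/cvgrPdist_le => e /h fe; near=> x.
have fxe : (f x <= e%:E)%E by near: x.
have fx : f x \is a fin_num by rewrite ge0_fin_numE// (le_lt_trans fxe)// ltry.
by rewrite sub0r normrN ger0_norm ?fine_ge0// -lee_fin fineK.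
Unshelve. all: by end_near.
Qed.

Lemma weight_small_diff : is_weight w -> forall e : R, 0 < e ->
  exists2 d : R, 0 < d & forall h, `|h| < d -> forall t, `|w (t + h) - w t| <= e * w t.
Proof.
move=> hw e e0; have w0 := weight_gt0 hw.
have f0 h : (0 <= ereal_sup [set (`|w (t + h) - w t| / w t)%:E | t in [set: R]])%E.
  apply: (@le_trans _ _ (`|w (0 + h) - w 0| / w 0)%:E); last first.
    by apply: ereal_sup_ubound; exists 0.
  by rewrite lee_fin divr_ge0// ltW.
have := (@ereal_cvg0P R (nbhs (0 : R)) (nbhs_filter (0 : R)) _ f0).1 (weight_diff_cvg0 hw) e e0.
move=> near0; have [d d0 dh] := (nbhs_realP _ _).1 near0.
exists d => // h /dh; rewrite add0r => /ereal_sup_real_le hh t.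
by rewrite -ler_pdivrMr//; apply: hh.
Qed.

End Weight.

Section BUC.
Variables (R : realType) (X : completeNormedModType R[i]) (w : R -> R).
Hypothesis hw : is_weight w.
Let w0 := weight_gt0 hw.

(** [BUCw] over the whole line with real constants in place of extended suprema; [buc_BUCw] returns
    to any [J] that contains 0. *)
Definition buc (phi : R -> X) : Prop :=
  [/\ continuous phi,
      exists2 c : R, 0 <= c & forall t, rnorm (phi t) <= c * w t &
      forall e : R, 0 < e -> exists2 d : R, 0 < d &
        forall h, `|h| < d -> forall t, rnorm (phi (t + h) - phi t) <= e * w t].

Lemma wnorm_le (J : set R) (phi : R -> X) (c : R) :
  (wnorm w J phi <= c%:E)%E <-> forall t, J t -> rnorm (phi t) <= c * w t.
Proof.
rewrite /wnorm ereal_sup_real_le; split=> h t Jt.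
  by rewrite -ler_pdivrMr ?h.
by rewrite ler_pdivrMr ?h.
Qed.

Lemma wnorm_ge0 (J : set R) (phi : R -> X) : J 0 -> (0 <= wnorm w J phi)%E.
Proof.
move=> J0; apply: (@le_trans _ _ (rnorm (phi 0) / w 0)%:E); last first.
  by apply: ereal_sup_ubound; exists 0.
by rewrite lee_fin divr_ge0 ?rnorm_ge0 ?ltW.
Qed.

Lemma BUCw_buc (phi : R -> X) : BUCw w [set: R] phi -> buc phi.
Proof.
move=> [cphi fin cvg0]; split.
- by apply/continuous_subspace_setT.
- have n0 := wnorm_ge0 phi (J := [set: R]) I.
  have nfin : wnorm w [set: R] phi \is a fin_num by rewrite ge0_fin_numE.
  exists (fine (wnorm w [set: R] phi)) => [|t]; first exact: fine_ge0.
  have /wnorm_le h :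
    (wnorm w [set: R] phi <= (fine (wnorm w [set: R] phi))%:E)%E by rewrite fineK.
  exact: h.
- move=> e e0.
  have n0 h : (0 <= wnorm w [set: R] (Defs.shift h phi \- phi)%R)%E by exact: wnorm_ge0.
  have := (@ereal_cvg0P R R _ (within_filter setT (nbhs_filter (0 : R))) _ n0).1 cvg0 e e0.
  rewrite near_withinE => /nbhs_realP[d d0 dh]; exists d => // h /dh.
  by rewrite add0r => /(_ I)/wnorm_le hh t; exact: hh.
Qed.

Lemma buc_BUCw (J : set R) (phi : R -> X) : J 0 -> buc phi -> BUCw w J phi.
Proof.
move=> J0 [cphi [c c0 phic] du]; split.
- exact: continuous_subspaceT.
- apply: (@le_lt_trans _ _ c%:E); last exact: ltry.
  by apply/wnorm_le => t _; exact: phic.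
- apply/ereal_cvg0P => [h|e /du[d d0 dh]]; first exact: wnorm_ge0.
  rewrite near_withinE; apply/nbhs_realP; exists d => // h /dh hh _.
  by rewrite add0r; apply/wnorm_le => t _; exact: hh.
Qed.

Lemma buc_op (T : X -> X) (K : R) (phi : R -> X) : linear T -> 0 <= K ->
  (forall x, rnorm (T x) <= K * rnorm x) -> buc phi -> buc (T \o phi).
Proof.
move=> lT K0 TK [cphi [c c0 phic] du]; split.
- by move=> x; apply: (bounded_op_continuous _ lT TK); exact: cphi.
- exists (K * c) => [|t]; first exact: mulr_ge0.
  by apply: le_trans (TK _) _; rewrite -mulrA ler_wpM2l.
- move=> e e0; have K1 : 0 < 1 + K by rewrite ltr_pwDl.
  have [d d0 dh] := du _ (divr_gt0 e0 K1); exists d => // h /dh hh t.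
  rewrite /= -linear_sub//; apply: le_trans (TK _) _.
  apply: le_trans (ler_wpM2l K0 (hh t)) _.
  rewrite mulrA; apply: ler_wpM2r (ltW (w0 _)) _ _ _.
  rewrite mulrCA; apply: ler_piMr; first exact: ltW.
  by rewrite ler_pdivrMr// mul1r lerDr.
Qed.

Lemma buc_sub (phi psi : R -> X) : buc phi -> buc psi ->
  buc (fun t => phi t - psi t).
Proof.
move=> [cphi [c c0 phic] du] [cpsi [c' c'0 psic] du']; split.
- by move=> x; apply: cvgB; [exact: cphi|exact: cpsi].
- exists (c + c') => [|t]; first exact: addr_ge0.
  by apply: le_trans (rnormB _ _) _; rewrite mulrDl lerD.
- move=> e e0; have e20 : 0 < e / 2 by rewrite divr_gt0.
  have [d d0 dh] := du _ e20; have [d' d'0 d'h] := du' _ e20.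
  exists (Num.min d d'); first by rewrite lt_min d0.
  move=> h; rewrite lt_min => /andP[/dh h1 /d'h h2] t.
  rewrite [e]splitr mulrDl.
  rewrite (_ : _ - _ - _ = (phi (t + h) - phi t) - (psi (t + h) - psi t)); last first.
    by rewrite !opprB [LHS](AC (2*2) (1*4*(3*2))).
  by apply: le_trans (rnormB _ _) _; rewrite lerD.
Qed.

(** The constant is a parameter because the iteration has to follow it: convolution with [f]
    multiplies weighted bounds by at most [c * pi]. *)
Definition kernel (c : R) (f : R -> R[i]) : Prop :=
  continuous (f : R -> R[i]^o) /\ forall s, rnorm (f s) * w s <= c * kappa s.

Lemma kernel_ge0 c f : kernel c f -> 0 <= c.
Proof.
move=> [_ /(_ 0) h]; rewrite -(pmulr_lge0 _ (kappa_gt0 0)).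
by apply: le_trans h; rewrite mulr_ge0 ?rnorm_ge0 ?ltW.
Qed.

Lemma reflect_continuous (phi : R -> X) t : continuous phi ->
  continuous (fun s => phi (t - s)).
Proof.
move=> cphi s; apply: (cvg_comp (fun s => t - s) phi); last exact: cphi.
by apply: cvgB; [exact: cvg_cst|exact: cvg_id].
Qed.

Lemma kernel_scale_continuous c f (phi : R -> X) t : kernel c f -> continuous phi ->
  continuous (fun s => f s *: phi (t - s)).
Proof.
move=> [cf _] cphi s; apply: cvgZ; first exact: cf.
exact: reflect_continuous.
Qed.

(** Submultiplicativity and evenness give [w (t - s) <= w t * w s]: the factor [w s] is absorbed by
    [f], the factor [w t] leaves the integral. *)
Lemma kernel_scale_le c C f (phi : R -> X) t : kernel c f ->
  0 <= C -> (forall t, rnorm (phi t) <= C * w t) ->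
  forall s, rnorm (f s *: phi (t - s)) <= c * C * w t * kappa s.
Proof.
move=> [_ fk] C0 phiC s; rewrite rnormZ.
have h1 : rnorm (phi (t - s)) <= C * (w t * w s).
  apply: le_trans (phiC _) _; rewrite ler_wpM2l// -(weight_even hw s).
  exact: weight_submul.
apply: le_trans (ler_wpM2l (rnorm_ge0 _) h1) _.
have wt0 := w0 t; move: (fk s); move: (rnorm (f s)) (w s) (w t) wt0 => r x y y0 h.
rewrite (_ : r * _ = C * y * (r * x)); last by ring.
rewrite (_ : c * _ * _ * _ = C * y * (c * kappa s)); last by ring.
by apply: ler_wpM2l h; apply: mulr_ge0 => //; exact: ltW.
Qed.

Lemma kernel_integrand c f (phi : R -> X) t : kernel c f -> continuous phi ->
  (exists2 C : R, 0 <= C & forall t, rnorm (phi t) <= C * w t) ->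
  integrand (fun s => f s *: phi (t - s)).
Proof.
move=> kf cphi [C C0 phiC]; split; first exact: kernel_scale_continuous kf cphi.
by exists (c * C * w t); exact: kernel_scale_le.
Qed.

Lemma convolution_le c C f (phi : R -> X) t : kernel c f -> continuous phi ->
  0 <= C -> (forall t, rnorm (phi t) <= C * w t) ->
  rnorm (convolution phi f t) <= c * C * pi * w t.
Proof.
move=> kf cphi C0 phiC.
rewrite (_ : c * C * pi * w t = c * C * w t * pi); last by ring.
apply: bochner_le; first exact: kernel_scale_continuous kf cphi.
exact: kernel_scale_le.
Qed.

(** Convolution commutes with translation, so the increment of the convolution is the convolution of
    the increment of [phi]. Continuity is then read off from the uniform modulus. *)
Lemma convolution_buc c f (phi : R -> X) : kernel c f -> buc phi ->
  buc (convolution phi f).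
Proof.
move=> kf [cphi [C C0 phiC] du]; have c0 := kernel_ge0 kf.
have K0 : 0 < 1 + c * pi by rewrite ltr_pwDl// mulr_ge0// pi_ge0.
have du' e : 0 < e -> exists2 d : R, 0 < d & forall h, `|h| < d ->
    forall t, rnorm (convolution phi f (t + h) - convolution phi f t) <= e * w t.
  move=> e0; have eK := divr_gt0 e0 K0.
  have [d d0 dh] := du _ eK; exists d => // h /dh hh t.
  have ig s : integrand (fun x => f x *: phi (s - x)).
    by apply: kernel_integrand kf cphi _; exists C.
  have cphih : continuous (fun t => phi (t + h) - phi t).
    move=> x; apply: cvgB; last exact: cphi.
    apply: (cvg_comp (fun x => x + h) phi); last exact: cphi.
    by apply: cvgD; [exact: cvg_id|exact: cvg_cst].
  rewrite -bochnerB//.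
  rewrite (_ : bochner_integral _ = convolution (fun t => phi (t + h) - phi t) f t).
    apply: le_trans (convolution_le t kf cphih (ltW eK) hh) _.
    apply: ler_wpM2r (ltW (w0 _)) _ _ _.
    rewrite (_ : c * _ * pi = e * (c * pi) / (1 + c * pi)); last by ring.
    by rewrite ler_pdivrMr// ler_pM2l// lerDr.
  congr bochner_integral; apply/funext => s.
  by rewrite -scalerBr addrAC.
split => //; last first.
  exists (c * C * pi) => [|t]; first by rewrite !mulr_ge0// pi_ge0.
  exact: convolution_le.
move=> t; apply/continuous_rnormP => e e0.
have wt0 : 0 < 2 * w t by rewrite mulr_gt0.
have [d d0 dh] := du' _ (divr_gt0 e0 wt0); exists d => // h /dh/(_ t).
move=> /le_lt_trans; apply; rewrite invfM mulrA divfK ?gt_eqF//.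
by rewrite ltr_pdivrMr// mulr2n mulrDr mulr1 ltrDl.
Qed.

End BUC.

(** * Stability of [F] under convolution *)

Section ConvolutionMembership.
Variables (R : realType) (X : completeNormedModType R[i]) (w : R -> R).
Variables (J : set R) (F : set (R -> X)).
Hypotheses (hw : is_weight w) (J0 : J 0) (hF : admissible w J F).
Let w0 := weight_gt0 hw.
Let mu := @lebesgue_measure R.

Lemma admissible_sum (I : Type) (r : seq I) (a : I -> R[i]) (xi : I -> R -> X) :
  (forall i, F (xi i)) -> F (fun t => \sum_(i <- r) a i *: xi i t).
Proof.
move=> Fxi; elim: r => [|i r IH].
  by under eq_fun do rewrite big_nil; exact: adm_0 hF.
by under eq_fun do rewrite big_cons; apply: adm_linear hF _ _ _ (Fxi i) IH.
Qed.

(* The Riemann sums of [s |-> f s *: psi (t - s)] are combinations of translates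
   of [psi]; the weight is moved onto [f] so that their convergence is uniform
   in [t] with respect to [w t]. *)
Lemma convolution_mem (c : R) (f : R -> R[i]) (psi : R -> X) :
  kernel w c f -> BUCw w [set: R] psi -> F psi -> F (convolution psi f).
Proof.
move=> kf Bpsi Fpsi; have bpsi := BUCw_buc hw Bpsi.
have c0 := kernel_ge0 hw kf.
have [cpsi [C C0 psiC] du] := bpsi; have [cf fk] := kf.
have Bc : BUCw w J (convolution psi f).
  have bc := convolution_buc hw kf bpsi. exact: (buc_BUCw hw J0 bc).
apply: (adm_closed hF Bc) => e e0.
(* The constant left after integrating the second term of [bnd] below; [e1] will bound the
   oscillation of both [psi] and [w] over one cell. *)
pose Kc := 3 * c * pi * (C + 1).
have Kc0 : 0 <= Kc by rewrite !mulr_ge0// ?pi_ge0// addr_ge0.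
have [e1 e1_gt0 e1Kc] : exists2 e1, 0 < e1 & e1 * Kc <= e / 3.
  exists (e / (3 * (1 + Kc))).
    by rewrite divr_gt0// mulr_gt0// ltr_pwDl.
  rewrite (_ : _ * Kc = e / 3 * (Kc / (1 + Kc))); last by field; lra.
  apply: ler_piMr; first by rewrite divr_ge0 ?(ltW e0).
  by rewrite ler_pdivrMr ?ltr_pwDl// mul1r lerDr.
have [d1 d1_gt0 d1h] := du _ e1_gt0.
have [d2 d2_gt0 d2h] := weight_small_diff hw e1_gt0.
pose fw (s : R) : R[i]^o := (w s)%:C * f s.
have cw s : {for s, continuous (fun s => (w s)%:C : R[i]^o)}.
  apply/continuous_rnormP => a a0.
  have /cvgrPdist_lt/(_ _ a0) near_s := weight_continuous hw (x := s).
  have [d d0 dh] := (nbhs_realP _ _).1 near_s.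
  exists d => // h /dh; rewrite distrC => hh.
  by rewrite -rmorphB /= rnorm_real.
have cfw : continuous fw.
  by move=> s; apply: (@cvgM R[i] R (nbhs s) _ (fun s => (w s)%:C) f);
    [exact: cw|exact: cf].
have fwk s : rnorm (fw s) <= c * kappa s.
  by rewrite /fw rnormM rnorm_real gtr0_norm// mulrC.
have e2_gt0 : 0 < e / (3 * (1 + C)) by rewrite divr_gt0// mulr_gt0// ltr_pwDl.
have In := ereal_cvg0_lt (step_dominated cfw fwk) e2_gt0.
have [n [small_n dn1 dn2]] : exists n : nat,
    [/\ (\int[mu]_t (rnorm (fw t - step n fw t))%:E < (e / (3 * (1 + C)))%:E)%E,
        n.+1%:R^-1 < d1 & n.+1%:R^-1 < d2].
  have [N _ h] : \forall n \near \oo,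
    [/\ (\int[mu]_t (rnorm (fw t - step n fw t))%:E < (e / (3 * (1 + C)))%:E)%E,
        n.+1%:R^-1 < d1 & n.+1%:R^-1 < d2].
    near=> n; split; near: n => //.
      exact: near_infty_natSinv_lt (PosNum d1_gt0).
    exact: near_infty_natSinv_lt (PosNum d2_gt0).
  by exists N; apply: h => /=.
exists (fun t => riemann_sum n (fun s => f s *: psi (t - s))).
  rewrite /riemann_sum; under eq_fun do under eq_bigr do rewrite scalerA.
  apply: admissible_sum => i.
  (* The shift by minus a node may leave [J]; this is allowed because [psi] is a [BUCw] function on
     the whole line. *)
  have := adm_extension hF Bpsi Fpsi (- node R n i).
  exact.
apply: (@le_lt_trans _ _ (2 * e / 3)%:E); last by rewrite lte_fin; lra.
apply/(wnorm_le hw) => t _.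
have ig : integrand (fun s => f s *: psi (t - s)).
  by apply: (kernel_integrand hw t kf cpsi); exists C.
have sm := step_simple n (fun s => f s *: psi (t - s)).
rewrite -lee_fin; apply: (le_trans (bochner_dist_le (bochnerP ig) sm)).
have mfw : strongly_measurable fw.
  exists (fun n => step n fw) => [k|s]; first by exists (riemann_sum k fw); exact: step_simple.
  by apply: step_cvg; exact: cfw.
have m1 : measurable_fun setT (fun s : R => rnorm (fw s - step n fw s)).
  exact: strongly_measurable_norm mfw (step_simple n fw).
(* The first term is the step error of [fw], the second the change of [psi] and [w] between [s] and
   its node, with [3 * kappa s] replacing [kappa] at the node. The factor [w t] makes the estimate
   uniform in the weighted norm. *)
pose bnd (s : R) := w t * C * rnorm (fw s - step n fw s) + w t * (e1 * (3 * c * (C + 1))) * kappa s.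
have C10 : 0 <= C + 1 by rewrite addr_ge0.
have e10 := ltW e1_gt0; have wt0 := ltW (w0 t).
have wC0 : 0 <= w t * C by rewrite mulr_ge0.
have wc0 : 0 <= w t * (e1 * (3 * c * (C + 1))).
  by rewrite !mulr_ge0.
have mbnd1 : measurable_fun setT (fun s : R => w t * C * rnorm (fw s - step n fw s)).
  exact: measurable_funM.
have mbnd2 : measurable_fun setT (fun s : R => w t * (e1 * (3 * c * (C + 1))) * kappa s).
  by apply: measurable_funM => //; exact: measurable_kappa.
have pointwise s : rnorm (f s *: psi (t - s) - step n (fun s => f s *: psi (t - s)) s) <= bnd s.
  have wtC : rnorm (psi (t - s)) <= C * (w t * w s).
    apply: le_trans (psiC _) _; rewrite ler_wpM2l// -(weight_even hw s).
    exact: weight_submul hw _ _.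
  have [|ns] := boolP (- n.+1%:R <= s < n.+1%:R); last first.
    rewrite /bnd !step_out// !subr0.
    have : 0 <= w t * (e1 * (3 * c * (C + 1))) * kappa s by rewrite mulr_ge0 ?kappa_ge0.
    rewrite rnormZ /fw rnormM rnorm_real gtr0_norm// => p0.
    have := ler_wpM2l (rnorm_ge0 (f s)) wtC.
    move: (rnorm _) (rnorm _) p0 => x y p0 h; apply: (le_trans h).
    rewrite -[leLHS]addr0; apply: lerD => //.
    by rewrite le_eqVlt; apply/orP; left; apply/eqP; ring.
  move=> ns; rewrite /bnd !step_in//.
  have /andP[/node_of_near/andP[a0 a1] _] := ns.
  set a := node_of n s in a0 a1 *.
  have sa : `|a - s| < n.+1%:R^-1 by rewrite distrC ger0_norm.
  have as_ : `|s - a| < n.+1%:R^-1 by rewrite ger0_norm.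
  have ka : kappa a <= 3 * kappa s.
    apply: kappa_shift; rewrite distrC; apply: (le_trans (ltW sa)).
    by rewrite invf_le1 ?ltr0n// ler1n.
  have h1 : rnorm (psi (t - s) - psi (t - a)) <= e1 * (w t * w a).
    rewrite (_ : t - s = t - a + (a - s)); last by rewrite addrA subrK.
    apply: le_trans (d1h _ (lt_trans sa dn1) _) _; rewrite ler_wpM2l ?(ltW e1_gt0)//.
    by rewrite -(weight_even hw a); exact: weight_submul hw _ _.
  have h2 : `|w s - w a| <= e1 * w a.
    by have := d2h _ (lt_trans as_ dn2) a; rewrite subrKC.
  have fa := fk a.
  have h3 : rnorm (f s - f a) * w s <= rnorm (fw s - fw a) + e1 * (c * kappa a).
    rewrite -[w s](gtr0_norm (w0 s)) -rnorm_real mulrC -rnormM mulrBr.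
    rewrite (_ : _ - _ = (fw s - fw a) + ((w a)%:C - (w s)%:C) * f a); last first.
      by rewrite /fw mulrBl addrA subrK.
    apply: le_trans (rnormD _ _) _; rewrite lerD2l -rmorphB /= rnormM rnorm_real distrC.
    apply: le_trans (ler_wpM2r (rnorm_ge0 _) h2) _.
    by rewrite -mulrA ler_wpM2l ?(ltW e1_gt0)// mulrC.
  rewrite (_ : _ - _ = (f s - f a) *: psi (t - s) +
    f a *: (psi (t - s) - psi (t - a))); last first.
    by rewrite scalerBl scalerBr addrA subrK.
  apply: le_trans (rnormD _ _) _; rewrite !rnormZ.
  have g1 := ler_wpM2l (rnorm_ge0 (f s - f a)) wtC.
  have g2 := ler_wpM2l (rnorm_ge0 (f a)) h1.
  apply: (@le_trans _ _ (rnorm (f s - f a) * (C * (w t * w s)) +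
    rnorm (f a) * (e1 * (w t * w a)))); first exact: lerD g1 g2.
  apply: (@le_trans _ _ (w t * C * (rnorm (fw s - fw a) + e1 * (c * kappa a)) +
    w t * e1 * (c * kappa a))).
    apply: lerD.
      rewrite (_ : _ * _ = w t * C * (rnorm (f s - f a) * w s)); last by ring.
      by rewrite ler_wpM2l.
    rewrite (_ : _ * _ = w t * e1 * (rnorm (f a) * w a)); last by ring.
    by rewrite ler_wpM2l// mulr_ge0.
  rewrite mulrDr -addrA lerD2l.
  rewrite (_ : _ + _ = w t * e1 * c * (C + 1) * kappa a); last by ring.
  rewrite (_ : w t * (e1 * _) * _ = w t * e1 * c * (C + 1) * (3 * kappa s)); last by ring.
  by rewrite ler_wpM2l// !mulr_ge0.
apply: (@le_trans _ _ (\int[mu]_s (bnd s)%:E)%E).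
  apply: ge0_le_integral => //.
  - by move=> s _; rewrite lee_fin rnorm_ge0.
  - apply/measurable_EFinP.
    exact: strongly_measurable_norm (bochner_strongly_measurable (bochnerP ig)) sm.
  - by apply/measurable_EFinP; exact: measurable_funD.
  - by move=> s _; rewrite lee_fin.
rewrite /bnd; under eq_integral do rewrite EFinD.
rewrite ge0_integralD//; first last.
- exact/measurable_EFinP.
- by move=> s _; rewrite lee_fin mulr_ge0// kappa_ge0.
- exact/measurable_EFinP.
- by move=> s _; rewrite lee_fin mulr_ge0// rnorm_ge0.
rewrite [X in (_ + X)%E]integral_kappaZ//.
under eq_integral do rewrite EFinM.
rewrite ge0_integralZl//; first last.
- by move=> s _; rewrite lee_fin rnorm_ge0.
- exact/measurable_EFinP.
apply: (@le_trans _ _ ((w t * C)%:E * (e / (3 * (1 + C)))%:E +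
    (w t * (e1 * (3 * c * (C + 1))) * pi)%:E)%E).
  apply: leeD => //; apply: lee_pmul => //; last exact: ltW.
  by apply: integral_ge0 => s _; rewrite lee_fin rnorm_ge0.
rewrite -EFinM -EFinD lee_fin.
rewrite (_ : _ * pi = w t * (e1 * Kc)); last by rewrite /Kc; ring.
rewrite (_ : 2 * e / 3 * w t = w t * (e / 3) + w t * (e / 3)); last by field.
apply: lerD; last by rewrite ler_wpM2l// ltW.
rewrite -mulrA; apply: ler_wpM2l (ltW (w0 _)) _ _ _.
rewrite (_ : C * (e / (3 * (1 + C))) = e / 3 * (C / (1 + C))); last by field; lra.
apply: ler_piMr; first by rewrite divr_ge0 ?(ltW e0).
by rewrite ler_pdivrMr ?ltr_pwDl// mul1r lerDr.
Unshelve. all: by end_near.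
Qed.

End ConvolutionMembership.

(** * Transfer of the differential operator to the kernel *)

Section Transfer.
Variables (R : realType) (X : completeNormedModType R[i]).
Variables (m : nat) (b : 'I_m.+1 -> R[i]) (l0 : R[i]) (phi : R -> X).
Hypothesis Cphi : Cm m phi.

Notation cder f f' t := (has_der (f : R -> R[i]^o) f' t).

(** [B - l0] applied to [g 0] when [g] lists its successive derivatives. No signs occur when it
    replaces [B - l0] on [phi]: the reflection [s |-> t - s] compensates those of integration by
    parts. *)
Definition shifted_op (g : nat -> R -> R[i]) (s : R) : R[i] :=
  \sum_(j < m.+1) b j * g j s - l0 * g 0%N s.

Lemma rderiven_has_der j t : (j < m)%N ->
  has_der (rderiven j phi) (rderiven j.+1 phi) t.
Proof. by move=> jm; have := Cphi.1 j jm t; exact: has_der_quotient. Qed.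

Lemma rderiven_continuous j : (j <= m)%N -> continuous (rderiven j phi).
Proof.
rewrite leq_eqVlt => /orP[/eqP ->|jm]; first exact: Cphi.2.
by move=> t; exact: has_der_continuous (rderiven_has_der t jm).
Qed.

Section CompactSupport.
Variables (h : nat -> R -> R[i]) (r : R).
Hypothesis ch : forall j, (j <= m)%N -> continuous (h j : R -> R[i]^o).
Hypothesis dh : forall j t, (j < m)%N -> cder (h j) (h j.+1) t.
Hypothesis h0 : forall j s, (j <= m)%N -> r < `|s| -> h j s = 0.

Lemma compact_integrand i (u : R -> X) t : (i <= m)%N -> continuous u ->
  integrand (fun s => h i s *: u (t - s)).
Proof.
move=> im cu; apply: (@integrand_support _ _ _ r).
  move=> s; apply: cvgZ; [exact: ch|exact: reflect_continuous].
by move=> s rs; rewrite h0// scale0r.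
Qed.

(** The difference of the two integrands is the derivative of [h i s *: rderiven a phi (t - s)],
    which has compact support. *)
Lemma integrate_by_parts a i t : (a + i < m)%N ->
  bochner_integral (fun s => h i s *: rderiven a.+1 phi (t - s)) =
  bochner_integral (fun s => h i.+1 s *: rderiven a phi (t - s)).
Proof.
move=> aim.
have am : (a < m)%N by apply: leq_ltn_trans aim; exact: leq_addr.
have im : (i < m)%N by apply: leq_ltn_trans aim; exact: leq_addl.
have i1 := compact_integrand t (ltnW im) (rderiven_continuous am).
have i2 := compact_integrand t im (rderiven_continuous (ltnW am)).
apply/esym/eqP; rewrite -subr_eq0 -bochnerB//; apply/eqP.
apply: (@bochner_derivative _ _ (fun s => h i s *: rderiven a phi (t - s)) _ r).
- move=> s; have := has_derM (dh s im) (has_der_reflect (rderiven_has_der (t - s) am)).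
  by congr has_der; apply/funext => x; rewrite scalerN.
- by have [] := integrandD i2 (integrandZ (-1) i1); under eq_fun do rewrite scaleN1r.
- by move=> s rs; rewrite h0 ?scale0r// ltnW.
- by move=> s rs; rewrite !h0 ?scale0r ?subr0// ltnW.
Qed.

Lemma integrate_by_parts_iter a i t : (a + i <= m)%N ->
  bochner_integral (fun s => h i s *: rderiven a phi (t - s)) =
  bochner_integral (fun s => h (a + i)%N s *: phi (t - s)).
Proof.
elim: a i => [|a IH] i aim; first by [].
rewrite (integrate_by_parts t aim) (IH i.+1); last by rewrite addnS.
by rewrite addnS addSn.
Qed.

Lemma transfer_compact t :
  bochner_integral (fun s => h 0%N s *: (op_B b phi (t - s) - l0 *: phi (t - s))) =
  bochner_integral (fun s => shifted_op h s *: phi (t - s)).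
Proof.
have cphi : continuous phi := @rderiven_continuous 0%N (leq0n m).
have i1 (j : 'I_m.+1) : integrand (fun s => h 0%N s *: rderiven j phi (t - s)).
  by apply: compact_integrand => //; apply: rderiven_continuous; rewrite -ltnS.
have i2 (j : 'I_m.+1) : integrand (fun s => h j s *: phi (t - s)).
  by apply: compact_integrand => //; rewrite -ltnS.
have i0 := compact_integrand t (leq0n m) cphi.
transitivity (\sum_(j < m.+1) b j *: bochner_integral (fun s => h j s *: phi (t - s)) -
  l0 *: bochner_integral (fun s => h 0%N s *: phi (t - s))).
  rewrite (eq_bigr (fun j : 'I_m.+1 => bochner_integral
      (fun s => b j *: (h 0%N s *: rderiven j phi (t - s))))); last first.
    move=> j _; have jm : (j + 0 <= m)%N by rewrite addn0 -ltnS.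
    by rewrite (bochnerZ (b j) (i1 j)) (integrate_by_parts_iter t jm) addn0.
  have ib (j : 'I_m.+1) : integrand (fun s => b j *: (h 0%N s *: rderiven j phi (t - s))).
    exact: integrandZ.
  rewrite -bochner_sum// -bochnerZ// -bochnerB; first last.
  - exact: integrandZ.
  - exact: integrand_sum.
  congr bochner_integral; apply/funext => s; rewrite scalerBr /op_B scaler_sumr.
  by congr (_ - _); [apply: eq_bigr => j _|]; rewrite !scalerA mulrC.
rewrite (eq_bigr (fun j : 'I_m.+1 => bochner_integral
    (fun s => b j *: (h j s *: phi (t - s))))); last by move=> j _; rewrite bochnerZ.
have ib (j : 'I_m.+1) : integrand (fun s => b j *: (h j s *: phi (t - s))).
  exact: integrandZ.
rewrite -bochner_sum// -bochnerZ// -bochnerB; first last.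
- exact: integrandZ.
- exact: integrand_sum.
congr bochner_integral; apply/funext => s; rewrite /shifted_op scalerBl scaler_suml.
by congr (_ - _); [apply: eq_bigr => j _|]; rewrite !scalerA.
Qed.

End CompactSupport.

Variables (w : R -> R) (T : X -> X) (K : R) (chi : R -> X).
Hypotheses (hw : is_weight w) (lT : linear T) (K0 : 0 <= K).
Hypothesis TK : forall x, rnorm (T x) <= K * rnorm x.
Hypotheses (bphi : buc w phi) (bchi : buc w chi).
Hypothesis chiE : forall t, T (op_B b phi t - l0 *: phi t) = chi t.
Let w0 := weight_gt0 hw.

Lemma shifted_op_continuous (g : nat -> R -> R[i]) :
  (forall j, (j <= m)%N -> continuous (g j : R -> R[i]^o)) ->
  continuous (shifted_op g : R -> R[i]^o).
Proof.
move=> cg.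
have sum_cont (r : seq 'I_m.+1) :
    continuous (fun s => \sum_(j <- r) b j * g j s : R[i]^o).
  elim: r => [|j r IH] t.
    by under eq_fun do rewrite big_nil; exact: cvg_cst.
  under eq_fun do rewrite big_cons.
  apply: (@cvgD R[i] R[i]^o); last exact: IH.
  by apply: (@cvgZ R[i] R[i]^o); [exact: cvg_cst|apply: cg; rewrite -ltnS].
move=> t; apply: (@cvgB R[i] R[i]^o); first exact: sum_cont.
by apply: (@cvgZ R[i] R[i]^o); [exact: cvg_cst|exact: cg].
Qed.

Lemma shifted_opB (g h : nat -> R -> R[i]) s :
  shifted_op (fun j s => g j s - h j s) s = shifted_op g s - shifted_op h s.
Proof.
rewrite /shifted_op (eq_bigr (fun j : 'I_m.+1 => b j * g j s - b j * h j s)).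
  by rewrite sumrB; ring.
by move=> j _; rewrite mulrBr.
Qed.

Lemma op_B_continuous : continuous (op_B b phi).
Proof.
rewrite /op_B.
have sum_cont (r : seq 'I_m.+1) :
    continuous (fun t => \sum_(j <- r) b j *: rderiven j phi t).
  elim: r => [|j r IH] t.
    by under eq_fun do rewrite big_nil; exact: cvg_cst.
  under eq_fun do rewrite big_cons; apply: cvgD; last exact: IH.
  by apply: cvgZ; [exact: cvg_cst|apply: rderiven_continuous; rewrite -ltnS].
by move=> t; exact: sum_cont.
Qed.

Lemma shifted_op_le (g : nat -> R -> R[i]) (s A : R) :
  (forall j, (j <= m)%N -> rnorm (g j s) <= A) ->
  rnorm (shifted_op g s) <= (\sum_(j < m.+1) rnorm (b j) + rnorm l0) * A.
Proof.
move=> gA; apply: le_trans (rnormB _ _) _; rewrite mulrDl mulr_suml.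
apply: lerD; last by rewrite rnormM ler_wpM2l ?rnorm_ge0// gA.
apply: le_trans (rnorm_sum _ _ _) _; apply: ler_sum => j _.
by rewrite rnormM ler_wpM2l ?rnorm_ge0// gA// -ltnS.
Qed.

(* The derivatives of [phi] need not be dominated by [w], so the integrations by
   parts are done against cutoffs [f eta(./r)], and only then [r -> oo]; [chi]
   and [phi] themselves are dominated. *)
Lemma convolution_transfer (f : nat -> R -> R[i]) (c : R) (t : R) :
  (forall k t, cder (f k) (f k.+1) t) ->
  (forall j s, (j <= m)%N -> rnorm (f j s) * (1 + `|s|) * w s <= c * kappa s) ->
  convolution chi (f 0%N) t = T (convolution phi (shifted_op f) t).
Proof.
move=> df fc.
have [eta [M [M0 [ceta deta etaM eta0 eta1]]]] := @cutoff_exists R m.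
have [cphi [Cp Cp0 phiC] _] := bphi; have [cchi [Cc Cc0 chiC] _] := bchi.
have cf j : continuous (f j : R -> R[i]^o) by move=> s; exact: has_der_continuous (df j s).
have c0 : 0 <= c.
  rewrite -(pmulr_lge0 _ (kappa_gt0 0)); apply: le_trans (fc 0%N 0 isT).
  by rewrite !mulr_ge0 ?rnorm_ge0// ?addr_ge0// ltW.
pose B := \sum_(j < m.+1) rnorm (b j) + rnorm l0.
have B0 : 0 <= B by rewrite addr_ge0 ?sumr_ge0 ?rnorm_ge0// => j _; exact: rnorm_ge0.
pose D0 := 2 ^+ m * (c * M).
have D00 : 0 <= D0 by rewrite !mulr_ge0// exprn_ge0.
(* Cutting off at radius [r] costs [O(1/r)], while the two sides compared do not depend on [r]. *)
have small (r : R) : 1 <= r ->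
    rnorm (convolution chi (f 0%N) t - T (convolution phi (shifted_op f) t)) <=
    (D0 * Cc * pi * w t + K * (B * D0 * Cp * pi * w t)) / r.
  move=> r1; have r0 : 0 < r by apply: lt_le_trans r1.
  (* The derivatives of [eta 0 (s / r)], with the factors of the chain rule; [h] lists those of its
     product with [f 0]. *)
  pose e j (s : R) : R[i] := (r^-1 ^+ j)%:C * eta j (r^-1 * s).
  have ce j : (j <= m)%N -> continuous (e j : R -> R[i]^o).
    move=> jm s; apply: (@cvgZ R[i] R[i]^o); first exact: cvg_cst.
    apply: (cvg_comp (fun s => r^-1 * s) (eta j)); last exact: ceta.
    by apply: cvgM; [exact: cvg_cst|exact: cvg_id].
  have de j s : (j < m)%N -> cder (e j) (e j.+1) s.
    move=> jm; have := has_derZ ((r^-1 ^+ j)%:C) (has_der_scale (deta j (r^-1 * s) jm)).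
    congr has_der; apply/funext => x.
    by rewrite scalerA -rmorphM -exprSr.
  have e0 j s : (j <= m)%N -> r < `|s| -> e j s = 0.
    move=> jm rs; rewrite /e eta0 ?mulr0// normrM gtr0_norm ?invr_gt0//.
    by rewrite ltr_pdivlMl// mulr1.
  pose h j := mulF j f e.
  have ch j : (j <= m)%N -> continuous (h j : R -> R[i]^o).
    move=> jm; apply: mulF_continuous => i ij //.
    by apply: ce; exact: leq_trans jm.
  have dh j s : (j < m)%N -> cder (h j) (h j.+1) s by exact: mulF_der.
  have h0 j s : (j <= m)%N -> r < `|s| -> h j s = 0.
    move=> jm rs; apply: mulF_zero => i ij; apply: e0 => //.
    exact: leq_trans jm.
  (* [A] bounds the derivatives of [f] at [s], and [q] bounds both
     [|eta 0 (s / r) - 1| <= M * |s| / r] and the derivatives of the cutoff, at most [M / r]. The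
     growth of [q] in [s] cancels against the factor [1 + |s|] in [fc]. *)
  have close j s : (j <= m)%N -> rnorm (h j s - f j s) * w s <= D0 / r * kappa s.
    move=> jm; pose A := c * kappa s / ((1 + `|s|) * w s).
    have s1 : 0 < 1 + `|s| by rewrite ltr_pwDl.
    have A0 : 0 <= A by rewrite !mulr_ge0 ?kappa_ge0// invr_ge0 mulr_ge0// ltW.
    pose q := M * (1 + `|s|) / r.
    have q0 : 0 <= q by rewrite !mulr_ge0// ?invr_ge0 ltW.
    have rs : `|r^-1 * s| = `|s| / r.
      by rewrite normrM gtr0_norm ?invr_gt0// mulrC.
    have := @mulF_cutoff R f e s A q j A0 q0.
    have fA i : (i <= j)%N -> rnorm (f i s) <= A.
      move=> ij; rewrite /A ler_pdivlMr ?mulr_gt0// mulrA; apply: fc.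
      exact: leq_trans jm.
    have eq_ i : (0 < i <= j)%N -> rnorm (e i s) <= q.
      case: i => // i /andP[_ ij]; rewrite /e rnormM rnorm_real.
      rewrite ger0_norm ?exprn_ge0 ?invr_ge0 ?(ltW r0)//.
      have h1 : r^-1 ^+ i.+1 <= r^-1.
        rewrite exprS ler_piMr ?invr_ge0 ?(ltW r0)//.
        by rewrite exprn_ile1 ?invr_ge0 ?(ltW r0)// invf_le1.
      have h2 := etaM i.+1 (r^-1 * s) (leq_trans ij jm).
      apply: (@le_trans _ _ (r^-1 * M)).
        by apply: ler_pM; rewrite ?rnorm_ge0// exprn_ge0// invr_ge0 ltW.
      by rewrite /q mulrC ler_wpM2r ?invr_ge0 ?(ltW r0)// ler_peMr// lerDl.
    have e1 : rnorm (e 0%N s - 1) <= q.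
      rewrite /e expr0 mul1r; apply: le_trans (eta1 _) _.
      by rewrite rs /q mulrA ler_wpM2r ?invr_ge0 ?(ltW r0)// ler_wpM2l// lerDr.
    move=> /(_ fA eq_ e1) => hh.
    apply: le_trans (ler_wpM2r (ltW (w0 s)) hh) _.
    have -> : 2 ^+ j * (A * q) * w s = 2 ^+ j * (c * M) / r * kappa s.
      have wn : w s != 0 by rewrite gt_eqF.
      have sn : 1 + `|s| != 0 by rewrite gt_eqF.
      have rn : r != 0 by rewrite gt_eqF.
      by rewrite /A /q; field; rewrite wn sn rn.
    rewrite ler_wpM2r ?kappa_ge0// ler_wpM2r ?invr_ge0 ?(ltW r0)// ler_wpM2r ?mulr_ge0//.
    by rewrite ler_weXn2l// ler1n.
  have kdiff j : (j <= m)%N -> kernel w (D0 / r) (fun s => h j s - f j s).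
    move=> jm; split; last by move=> s; exact: close.
    by move=> s; apply: (@cvgB R[i] R[i]^o); [exact: ch|exact: cf].
  have kPdiff : kernel w (B * (D0 / r))
      (shifted_op (fun j s => h j s - f j s)).
    split.
      by apply: shifted_op_continuous => j /kdiff[].
    move=> s.
    have hA j : (j <= m)%N -> rnorm (h j s - f j s) <= D0 / r * kappa s / w s.
      by move=> jm; rewrite ler_pdivlMr//; exact: close.
    have := @shifted_op_le (fun j s => h j s - f j s) s _ hA; rewrite -/B => hh.
    apply: le_trans (ler_wpM2r (ltW (w0 s)) hh) _.
    by rewrite mulrA divfK ?gt_eqF// mulrA.
  have kf j : (j <= m)%N -> kernel w c (f j).
    move=> jm; split=> // s; apply: le_trans (fc j s jm).
    by apply: ler_wpM2r (ltW (w0 s)) _ _ _; rewrite ler_peMr ?rnorm_ge0// lerDl.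
  have kPf : kernel w (B * c) (shifted_op f).
    split; first by apply: shifted_op_continuous => j _.
    move=> s; have hA j : (j <= m)%N -> rnorm (f j s) <= c * kappa s / w s.
      by move=> jm; rewrite ler_pdivlMr//; have [_] := kf j jm.
    have := @shifted_op_le f s _ hA; rewrite -/B => hh.
    apply: le_trans (ler_wpM2r (ltW (w0 s)) hh) _.
    by rewrite mulrA divfK ?gt_eqF// mulrA.
  have exp_ : exists2 C : R, 0 <= C & forall t, rnorm (phi t) <= C * w t by exists Cp.
  have exc : exists2 C : R, 0 <= C & forall t, rnorm (chi t) <= C * w t by exists Cc.
  (* For the compactly supported kernel the transfer is exact; [T] enters the integral and turns
     [(B - l0) phi] into [chi]. *)
  have compact : bochner_integral (fun s => h 0%N s *: chi (t - s)) =
      T (bochner_integral (fun s => shifted_op h s *: phi (t - s))).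
    rewrite -(transfer_compact ch dh h0) -(bochner_op lT K0 TK); last first.
      apply: (compact_integrand ch h0 (u := fun x => op_B b phi x - l0 *: phi x) t (leq0n m)).
      move=> x; apply: cvgB; first exact: op_B_continuous.
      by apply: cvgZ; [exact: cvg_cst|exact: cphi].
    congr bochner_integral; apply/funext => s /=.
    by rewrite linear_homogeneous// chiE.
  have E1 : convolution chi (fun s => h 0%N s - f 0%N s) t =
      bochner_integral (fun s => h 0%N s *: chi (t - s)) - convolution chi (f 0%N) t.
    have i1 := compact_integrand ch h0 t (leq0n m) cchi.
    have i2 := kernel_integrand hw t (kf 0%N (leq0n m)) cchi exc.
    rewrite -(bochnerB i1 i2).
    by congr bochner_integral; apply/funext => s; rewrite scalerBl.
  have iPh : integrand (fun s => shifted_op h s *: phi (t - s)).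
    apply: (@integrand_support _ _ _ r).
      move=> s; apply: cvgZ; last exact: reflect_continuous.
      exact: shifted_op_continuous.
    move=> s rs; rewrite /shifted_op h0// mulr0 subr0 big1 ?scale0r// => j _.
    by rewrite h0 ?mulr0// -ltnS.
  have E2 : convolution phi (shifted_op (fun j s => h j s - f j s)) t =
      bochner_integral (fun s => shifted_op h s *: phi (t - s)) -
      convolution phi (shifted_op f) t.
    rewrite -(bochnerB iPh (kernel_integrand hw t kPf cphi exp_)).
    by congr bochner_integral; apply/funext => s; rewrite -scalerBl shifted_opB.
  have n1 := convolution_le hw t (kdiff 0%N (leq0n m)) cchi Cc0 chiC.
  have n2 := convolution_le hw t kPdiff cphi Cp0 phiC.
  rewrite (_ : _ - _ = T (convolution phi (shifted_op (fun j s => h j s - f j s)) t) -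
     convolution chi (fun s => h 0%N s - f 0%N s) t); last first.
    have zmod (x y z : X) : x - y = (z - y) - (z - x).
      by rewrite opprB [RHS](AC (2*2) (3*2*(1*4)))/= subrr addr0.
    have TE2 := etrans (congr1 T E2) (linear_sub lT _ _).
    have E1' := etrans E1 (congr1 (fun u => u - _) compact).
    exact: etrans (zmod _ _ _) (esym (congr2 (fun u v => u - v) TE2 E1')).
  apply: le_trans (rnormB _ _) _; rewrite addrC mulrDl; apply: lerD.
    by apply: le_trans n1 _; rewrite le_eqVlt; apply/orP; left; apply/eqP; ring.
  apply: le_trans (TK _) _; apply: le_trans (ler_wpM2l K0 n2) _.
  by rewrite le_eqVlt; apply/orP; left; apply/eqP; ring.
apply/eqP; rewrite -subr_eq0; apply/eqP/rnorm_eq0/eqP.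
rewrite eq_le rnorm_ge0 andbT.
set Z := D0 * Cc * pi * w t + K * (B * D0 * Cp * pi * w t) in small.
apply/ler_addgt0Pr => e e0; rewrite add0r.
have Z0 : 0 <= Z.
  by rewrite /Z addr_ge0 ?mulr_ge0 ?pi_ge0 ?(ltW (w0 t)).
(* The radius [1 + Z / e] makes [Z / r] at most [e]. *)
have r1 : 1 <= 1 + Z / e by rewrite lerDl divr_ge0// ltW.
apply: le_trans (small _ r1) _; rewrite ler_pdivrMr ?(lt_le_trans _ r1)//.
by rewrite mulrDr mulr1 mulrCA divff ?gt_eqF// mulr1 lerDr ltW.
Qed.

End Transfer.

(** * Modulation and dilation *)

Section Modulation.
Variables (R : realType) (m : nat) (b : 'I_m.+1 -> R[i]) (s0 : R).

Notation cder f f' t := (has_der (f : R -> R[i]^o) f' t).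
Notation lambda := (p_B b s0).
Notation ch := (character s0).
Let c : R[i] := 'i%C * s0%:C.
Let a : R := rnorm c.
Let a0 : 0 <= a. Proof. exact: rnorm_ge0. Qed.

Lemma character_has_der t : cder ch (fun t => c * ch t) t.
Proof.
have dcos x : cder (fun x => (cos x)%:C) (fun x => (- sin x)%:C) x.
  exact: is_derive_has_der (is_derive_cos x).
have dsin x : cder (fun x => (sin x)%:C) (fun x => (cos x)%:C) x.
  exact: is_derive_has_der (is_derive_sin x).
have := has_derD (has_der_scale (dcos (s0 * t)))
  (has_derZ 'i%C (has_der_scale (dsin (s0 * t)))).
congr has_der; apply/funext => x; rewrite /c /character /GRing.scale /=;
  apply/eqP; rewrite eq_complex /=; apply/andP; split; apply/eqP; ring.
Qed.

Lemma character_opp t : ch (- t) * ch t = 1.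
Proof.
rewrite /character mulrN cosN sinN; apply/eqP; rewrite eq_complex /=.
apply/andP; split; apply/eqP; last by ring.
by have := cos2Dsin2 (s0 * t); move=> <-; ring.
Qed.

Lemma rnorm_character t : rnorm (ch t) = 1.
Proof.
by rewrite /rnorm normc_def /character /= cos2Dsin2 sqrtr1.
Qed.

(* If [g] lists the derivatives of a function [g 0], then [modulate g] lists those
   of [ch * g 0]: conjugation by [ch] turns [d/dt] into [Lop], and [B - p_B(s0)]
   into [Qop]. *)
Definition Lop (g : nat -> R -> R[i]) (k : nat) (t : R) : R[i] := g k.+1 t + c * g k t.

Definition modulate (g : nat -> R -> R[i]) (k : nat) (t : R) : R[i] :=
  ch t * iter k Lop g 0%N t.

Definition Qop (g : nat -> R -> R[i]) (k : nat) (t : R) : R[i] :=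
  \sum_(j < m.+1) b j * iter j Lop g k t - lambda * g k t.

Definition derivatives (g : nat -> R -> R[i]) : Prop :=
  forall k t, cder (g k) (g k.+1) t.

Lemma Lop_derivatives g j : derivatives g -> derivatives (iter j Lop g).
Proof.
move=> dg; elim: j => [//|j IH] k t.
exact: (has_derD (IH k.+1 t) (has_derZ c (IH k t))).
Qed.

Lemma modulate_derivatives g : derivatives g -> derivatives (modulate g).
Proof.
move=> dg k t; have := has_derM (character_has_der t) (@Lop_derivatives g k dg 0%N t).
congr has_der; apply/funext => x.
by rewrite /modulate iterS /Lop /GRing.scale/=; ring.
Qed.

Lemma Qop_derivatives g : derivatives g -> derivatives (Qop g).
Proof.
move=> dg k t; apply: (has_derB (V := R[i]^o)); last exact: has_derZ.
apply: (has_der_sum (V := R[i]^o)) => j.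
by apply: (has_derZ (V := R[i]^o)); exact: Lop_derivatives.
Qed.

(** This closes the iteration: the transferred kernel is again modulated, with [Qop g] in place of
    [g]. *)
Lemma shifted_op_modulate g : shifted_op b lambda (modulate g) = modulate (Qop g) 0%N.
Proof.
apply/funext => t; rewrite /shifted_op /modulate /Qop /= mulrBr mulr_sumr.
congr (_ - _); last by ring.
by apply: eq_bigr => j _; ring.
Qed.

(* The maximum of [|(x + c)^j - c^j|] over [|x| <= d]. *)
Definition gap (d : R) (j : nat) : R := (d + a) ^+ j - a ^+ j.

Lemma gap_ge0 d j : 0 <= d -> 0 <= gap d j.
Proof.
by move=> d0; rewrite subr_ge0 lerXn2r ?nnegrE ?addr_ge0// lerDr.
Qed.

(** The bound is linear in [d], with a constant independent of [d <= 1]; this is what makes [q(d)]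
    tend to 0. *)
Lemma gap_le d j : 0 <= d -> d <= 1 -> gap d j <= d * (j%:R * (1 + a) ^+ j).
Proof.
move=> d0 d1; elim: j => [|j IH]; first by rewrite /gap !expr0 subrr mul0r mulr0.
have a1 : 0 <= 1 + a by rewrite addr_ge0.
have -> : gap d j.+1 = gap d j * (d + a) + d * a ^+ j by rewrite /gap !exprS; ring.
have -> : d * (j.+1%:R * (1 + a) ^+ j.+1) =
   d * (j%:R * (1 + a) ^+ j) * (1 + a) + d * ((1 + a) ^+ j * (1 + a)).
  by rewrite -[j.+1%:R]natr1 exprS; ring.
apply: lerD.
  by apply: ler_pM; rewrite ?gap_ge0 ?addr_ge0// lerD2r.
rewrite ler_wpM2l//; apply: (@le_trans _ _ ((1 + a) ^+ j)).
  by rewrite lerXn2r ?nnegrE// lerDr.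
by rewrite ler_peMr ?exprn_ge0// lerDl.
Qed.

Section Bounds.
Variables (g : nat -> R -> R[i]) (t A d : R).
Hypothesis gA : forall k, rnorm (g k t) <= A * d ^+ k.
Let A0 : 0 <= A.
Proof. by have := gA 0%N; rewrite expr0 mulr1; apply: le_trans; exact: rnorm_ge0. Qed.

(** With [D] the passage to the next derivative, [(D + c)^(j+1) - c^(j+1) = (D + c) ((D + c)^j -
    c^j) + c^j D]. Replacing [D] by its size [d] and [c] by [a] gives the recursion satisfied by
    [gap]. *)
Lemma Lop_gap j k :
  rnorm (iter j Lop g k t - c ^+ j * g k t) <= A * d ^+ k * gap d j.
Proof.
elim: j k => [|j IH] k.
  by rewrite /gap /= expr0 mul1r subrr rnorm0 !expr0 subrr mulr0.
rewrite iterS /Lop.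
rewrite (_ : _ - _ = (iter j Lop g k.+1 t - c ^+ j * g k.+1 t) +
  c * (iter j Lop g k t - c ^+ j * g k t) + c ^+ j * g k.+1 t); last first.
  by rewrite exprS; ring.
apply: le_trans (rnormD _ _) _; apply: le_trans (lerD (rnormD _ _) (lexx _)) _.
rewrite (rnormM c) (rnormM (c ^+ j)) rnormX -/a.
apply: (@le_trans _ _ (A * d ^+ k.+1 * gap d j + a * (A * d ^+ k * gap d j) +
  a ^+ j * (A * d ^+ k.+1))).
  apply: lerD; first apply: lerD; first exact: IH.
    by apply: ler_wpM2l (IH k); exact: a0.
  by apply: ler_wpM2l (gA k.+1); rewrite exprn_ge0.
by rewrite le_eqVlt; apply/orP; left; apply/eqP; rewrite /gap !exprS; ring.
Qed.

Lemma Lop_le j k : rnorm (iter j Lop g k t) <= A * d ^+ k * (d + a) ^+ j.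
Proof.
rewrite -(subrK (c ^+ j * g k t) (iter j Lop g k t)).
apply: le_trans (rnormD _ _) _; apply: le_trans (lerD (Lop_gap _ _) (lexx _)) _.
rewrite (rnormM (c ^+ j)) rnormX -/a /gap mulrBr -lerBrDl opprB addrCA subrr addr0.
by rewrite mulrC ler_wpM2r ?exprn_ge0.
Qed.

(** Since [p_B b s0] is the sum of the [b j * c ^+ j], the constant terms cancel and only the
    differences estimated in [Lop_gap] remain: the quantitative form of [Q(0) = 0]. *)
Lemma Qop_le k :
  rnorm (Qop g k t) <= A * (\sum_(j < m.+1) rnorm (b j) * gap d j) * d ^+ k.
Proof.
rewrite /Qop /p_B -/c mulr_suml -sumrB.
apply: le_trans (rnorm_sum _ _ _) _; rewrite mulr_sumr mulr_suml.
apply: ler_sum => j _; rewrite -mulrA -mulrBr rnormM.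
apply: le_trans (ler_wpM2l (rnorm_ge0 _) (Lop_gap _ _)) _.
by rewrite le_eqVlt; apply/orP; left; apply/eqP; ring.
Qed.

End Bounds.

End Modulation.

(** * Dilated powers of the sinc function *)

Section BandLimited.
Variable R : realType.

Fixpoint sinc_pow (p : nat) : nat -> R -> R[i] :=
  match p with
  | 0 => fun k _ => (k == 0%N)%:R
  | p'.+1 => fun k => mulF k (fun j t => (sinc j t)%:C) (sinc_pow p')
  end.

Lemma sinc_pow_derivatives p : derivatives (sinc_pow p).
Proof.
elim: p => [|p IH] k t; first by case: k => [|k]; exact: has_der_cst.
apply: (@mulF_der _ k.+1); [move=> j s _|move=> j s _; exact: IH|exact: ltnSn].
exact: is_derive_has_der (sinc_derive j s).
Qed.

(** Each factor contributes one power of decay and adds 2 to the bandwidth, both from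
    [sinc_decay]. *)
Lemma sinc_pow_le p k t :
  rnorm (sinc_pow p k t) <= (2 / (1 + `|t|)) ^+ p * (2 * p%:R) ^+ k.
Proof.
have A0 : 0 <= 2 / (1 + `|t|) by rewrite divr_ge0// addr_ge0.
elim: p k => [|p IH] k.
  rewrite mulr0 expr0 mul1r /=; case: k => [|k] /=.
    by rewrite expr0 /rnorm normr1.
  by rewrite rnorm0 exprn_ge0.
have -> : 2 * p.+1%:R = 2 + 2 * p%:R :> R by rewrite -natr1; ring.
have B0 : 0 <= (2 / (1 + `|t|)) ^+ p by rewrite exprn_ge0.
have p0 : 0 <= 2 * p%:R :> R by rewrite mulr_ge0.
rewrite [X in _ <= X * _]exprS.
apply: (@mulF_bound _ _ _ _ _ 2) => // j.
by rewrite rnorm_real mulrAC; exact: sinc_decay.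
Qed.

Lemma sinc_pow0 p t : sinc_pow p 0%N t = (sinc 0 t ^+ p)%:C.
Proof.
elim: p => [|p IH] /=; first by rewrite expr0.
by rewrite IH -rmorphM -exprS.
Qed.

(** The factor [e ^+ k] comes from the chain rule: dilation scales the bandwidth by [e]. *)
Definition sinc_dilate (p : nat) (e : R) (k : nat) (t : R) : R[i] :=
  (e ^+ k)%:C * sinc_pow p k (e * t).

Lemma sinc_dilate_derivatives p e : derivatives (sinc_dilate p e).
Proof.
move=> k t.
have := has_derZ ((e ^+ k)%:C) (has_der_scale (@sinc_pow_derivatives p k (e * t))).
congr has_der; apply/funext => x.
by rewrite scalerA -rmorphM -exprSr.
Qed.

Lemma sinc_dilate_le p e k t : 0 <= e ->
  rnorm (sinc_dilate p e k t) <= (2 / (1 + e * `|t|)) ^+ p * (e * (2 * p%:R)) ^+ k.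
Proof.
move=> e0; rewrite /sinc_dilate rnormM rnorm_real ger0_norm ?exprn_ge0//.
rewrite [(e * _) ^+ k]exprMn [leRHS]mulrCA ler_wpM2l ?exprn_ge0//.
by have := sinc_pow_le p k (e * t); rewrite normrM ger0_norm.
Qed.

Lemma sinc_dilate0 p e t : sinc_dilate p e 0%N t = (sinc 0 (e * t) ^+ p)%:C.
Proof. by rewrite /sinc_dilate expr0 mul1r sinc_pow0. Qed.

(* The decay of [sinc^(2N+4)] absorbs the weight and leaves an integrable
   majorant. *)
Lemma decay_kappa (w : R -> R) (N : nat) (W e : R) : (forall t, 1 <= w t) ->
  (forall t, w t <= W * (1 + `|t|) ^+ N) -> 0 < e -> e <= 1 ->
  exists2 c : R, 0 <= c & forall t,
    (2 / (1 + e * `|t|)) ^+ (N.+1 + N.+3) * (1 + `|t|) * w t <= c * kappa t.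
Proof.
move=> w1 wW e0 e1.
have W0 : 0 <= W.
  have := le_trans (w1 0) (wW 0); rewrite normr0 addr0 expr1n mulr1.
  exact: le_trans.
(* The first [N + 1] powers pay for the weight and for the factor [1 + |t|] used by the cutoffs, the
   other [N + 3] for [kappa]. The total [2 N + 4] is even, so the power of sinc is nonnegative. *)
set p := (N.+1 + N.+3)%N.
exists ((2 / e) ^+ p * W) => [|t]; first by rewrite mulr_ge0 ?exprn_ge0// divr_ge0// ltW.
set x := `|t|; have x0 : 0 <= x by exact: normr_ge0.
have x1 : 1 <= 1 + x by rewrite lerDl.
have x1_gt0 : 0 < 1 + x by apply: lt_le_trans x1.
have ex0 : 0 < 1 + e * x by rewrite ltr_pwDl// mulr_ge0// ltW.
have base : 2 / (1 + e * x) <= 2 / e * (1 + x)^-1.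
  rewrite -mulrA -invfM ler_pM2l// lef_pV2 ?posrE ?mulr_gt0//.
  by rewrite mulrDr mulr1 lerD2r.
have h1 : (2 / (1 + e * x)) ^+ p <= (2 / e) ^+ p * (1 + x) ^- p.
  rewrite -exprVn -[leRHS]exprMn; apply: lerXn2r base; rewrite nnegrE.
    by rewrite divr_ge0// ltW.
  by rewrite mulr_ge0 ?divr_ge0 ?invr_ge0// ltW.
have h2 : (1 + x) ^- p * (1 + x) * (1 + x) ^+ N <= kappa t.
  rewrite /kappa -(real_normK (num_real t)) -/x.
  rewrite -mulrA -exprS mulrC ler_pdivrMr ?exprn_gt0// mulrC ler_pdivlMr; last first.
    by rewrite ltr_pwDl// sqr_ge0.
  rewrite /p exprD ler_wpM2l ?exprn_ge0 ?(ltW x1_gt0)//.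
  rewrite 3!(exprS (1 + x)).
  have : 1 <= (1 + x) ^+ N by rewrite exprn_ege1.
  move: ((1 + x) ^+ N) => y y1.
  apply: (@le_trans _ _ ((1 + x) * (1 + x))); first by nra.
  by apply: ler_wpM2l (ltW x1_gt0) _ _ _; apply: ler_peMr; [exact: ltW|nra].
apply: (@le_trans _ _ ((2 / e) ^+ p * (1 + x) ^- p * (1 + x) * (W * (1 + x) ^+ N))).
  apply: ler_pM => //.
  - by rewrite mulr_ge0// ?(ltW x1_gt0)// exprn_ge0// divr_ge0// addr_ge0// mulr_ge0// ltW.
  - by apply: le_trans (w1 t).
  - by rewrite ler_wpM2r ?(ltW x1_gt0).
rewrite (_ : _ * _ = (2 / e) ^+ p * W * ((1 + x) ^- p * (1 + x) * (1 + x) ^+ N)); last by ring.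
by rewrite ler_wpM2l// mulr_ge0 ?exprn_ge0// divr_ge0// ltW.
Qed.

End BandLimited.

(** * The local Neumann series *)

(* An analytic substitute for "the Fourier transform is supported in [[-d, d]]". *)
Definition band_limited (R : realType) (H : R -> R) (d A : R)
    (g : nat -> R -> R[i]) : Prop :=
  derivatives g /\ forall k t, rnorm (g k t) <= A * H t * d ^+ k.

Section LocalNeumannSeries.
Variables (R : realType) (X : completeNormedModType R[i]).
Variables (J : set R) (w : R -> R) (F : set (R -> X)).
Hypotheses (J0 : J 0) (hw : is_weight w) (hF : admissible w J F).
Variables (m : nat) (b : 'I_m.+1 -> R[i]) (s0 : R).
Variables (phi psi : R -> X) (T : X -> X) (K : R).
Hypotheses (Cphi : Cm m phi) (bphi : buc w phi).
Hypotheses (Bpsi : BUCw w [set: R] psi) (Fpsi : F psi).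
Hypotheses (lT : linear T) (K0 : 0 <= K).
Hypothesis TK : forall x, rnorm (T x) <= K * rnorm x.
Hypothesis TF : forall xi, F xi -> F (T \o xi).
Hypothesis resolvent_eq : forall t,
  T (op_B b phi t - p_B b s0 *: phi t) = T (psi t) - phi t.
Variables (H : R -> R) (c d q : R).
Hypotheses (d0 : 0 <= d) (q0 : 0 < q).
Hypothesis gap_q : \sum_(j < m.+1) rnorm (b j) * gap s0 d j <= q.
Hypothesis Hc : forall s, H s * (1 + `|s|) * w s <= c * kappa s.
Let w0 := weight_gt0 hw.
Let a := rnorm ('i%C * s0%:C : R[i]).

Notation dominated := (band_limited H d).

Let H_ge0 A g : 0 < A -> dominated A g -> forall t, 0 <= H t.
Proof.
move=> A0 [_ gA] t; rewrite -(pmulr_rge0 _ A0).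
by have := gA 0%N t; rewrite expr0 mulr1; apply: le_trans; exact: rnorm_ge0.
Qed.

Lemma modulate_kernel A g : 0 < A -> dominated A g ->
  kernel w (A * c) (modulate s0 g 0%N).
Proof.
move=> A0 dg; have [dgd gA] := dg; split.
  by move=> t; exact: has_der_continuous (modulate_derivatives s0 dgd 0%N t).
move=> s; rewrite /modulate rnormM rnorm_character mul1r /=.
have := gA 0%N s; rewrite expr0 mulr1 => h.
apply: le_trans (ler_wpM2r (ltW (w0 s)) h) _; rewrite -!mulrA ler_wpM2l ?(ltW A0)//.
apply: le_trans (Hc s); rewrite ler_wpM2r ?(ltW (w0 s))// ler_peMr ?lerDl//.
exact: H_ge0 A0 dg s.
Qed.

(** [convolution_transfer] with [chi = T psi - phi], solved for the convolution of [phi]. *)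
Lemma modulate_convolution A g t : 0 < A -> dominated A g ->
  convolution phi (modulate s0 g 0%N) t =
  T (convolution psi (modulate s0 g 0%N) t) -
  T (convolution phi (modulate s0 (Qop b s0 g) 0%N) t).
Proof.
move=> A0 dg; have [dgd gA] := dg; have kg := modulate_kernel A0 dg.
have bpsi := BUCw_buc hw Bpsi; have bTpsi := buc_op hw lT K0 TK bpsi.
have bchi := buc_sub bTpsi bphi.
have [cphi ephi _] := bphi; have [cpsi epsi _] := bpsi; have [cTpsi eTpsi _] := bTpsi.
(* The base [1 + d + a] is at least 1, so its [m]-th power serves all orders [j <= m]. *)
have decay j s : (j <= m)%N ->
    rnorm (modulate s0 g j s) * (1 + `|s|) * w s <= A * (1 + d + a) ^+ m * c * kappa s.
  move=> jm; rewrite /modulate rnormM rnorm_character mul1r.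
  have := @Lop_le R s0 g s (A * H s) d (fun k => gA k s) j 0.
  rewrite expr0 mulr1 -/a => h.
  have a0 : 0 <= a by exact: rnorm_ge0.
  have h' : (d + a) ^+ j <= (1 + d + a) ^+ m.
    apply: (@le_trans _ _ ((1 + d + a) ^+ j)).
      by rewrite lerXn2r ?nnegrE ?addr_ge0// lerD2r lerDr.
    by rewrite ler_weXn2l// -addrA lerDl addr_ge0.
  have s1 : 0 <= 1 + `|s| by rewrite addr_ge0.
  have AH : 0 <= A * H s by rewrite mulr_ge0 ?(ltW A0)//; exact: H_ge0 A0 dg s.
  have hh := le_trans h (ler_wpM2l AH h').
  have y0 : 0 <= (1 + d + a) ^+ m by rewrite exprn_ge0// !addr_ge0.
  rewrite -mulrA; apply: le_trans (ler_wpM2r (mulr_ge0 s1 (ltW (w0 s))) hh) _.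
  move: ((1 + d + a) ^+ m) y0 => y y0; have := Hc s.
  move: (1 + `|s|) (w s) (H s) => p r z Hcs.
  rewrite (_ : A * z * y * (p * r) = A * y * (z * p * r)); last by ring.
  by rewrite -[leRHS]mulrA ler_wpM2l// mulr_ge0 ?(ltW A0).
have := convolution_transfer Cphi hw lT K0 TK bphi bchi resolvent_eq t
  (modulate_derivatives s0 dgd) decay.
rewrite shifted_op_modulate => <-.
have i1 := kernel_integrand hw t kg cpsi epsi.
have i2 := kernel_integrand hw t kg cphi ephi.
have i3 := kernel_integrand hw t kg cTpsi eTpsi.
have -> : convolution (fun t => (T \o psi) t - phi t) (modulate s0 g 0%N) t =
    T (convolution psi (modulate s0 g 0%N) t) - convolution phi (modulate s0 g 0%N) t.
  rewrite -(bochner_op lT K0 TK i1).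
  have i3' : integrand (T \o (fun s => modulate s0 g 0%N s *: psi (t - s))).
    exact: integrand_op lT K0 TK i1.
  rewrite -(bochnerB i3' i2); congr bochner_integral; apply/funext => s /=.
  by rewrite scalerBr (linear_homogeneous lT).
by rewrite opprB addrCA subrr addr0.
Qed.

(* Neumann series for the resolvent near [p_B b s0], stopped after [n] terms. *)
Lemma spectral_iteration (C : R) : 0 <= C -> (forall t, rnorm (phi t) <= C * w t) ->
  forall n A g, 0 < A -> dominated A g ->
  exists2 eta, F eta & forall t,
    rnorm (convolution phi (modulate s0 g 0%N) t - eta t) <=
    (K * q) ^+ n * (A * c * C * pi) * w t.
Proof.
move=> C0 phiC; have [cphi _ _] := bphi.
elim=> [|n IH] A g A0 dg.
  exists (cst 0) => [|t]; first exact: adm_0 hF.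
  rewrite subr0 expr0 mul1r.
  have h := convolution_le hw t (modulate_kernel A0 dg) cphi C0 phiC. exact: h.
(* [H] and [d] are unchanged, so the induction hypothesis applies to [Qop g] with only [A] replaced
   by [A * q]; the factor [K] comes from [T]. *)
have dQ : dominated (A * q) (Qop b s0 g).
  have [dgd gA] := dg; split; first exact: Qop_derivatives.
  move=> k t; have := @Qop_le R m b s0 g t (A * H t) d (fun k => gA k t) k.
  move=> /le_trans; apply; apply: ler_wpM2r; first by rewrite exprn_ge0.
  rewrite mulrAC; apply: ler_wpM2r (H_ge0 A0 dg t) _ _ _.
  by apply: ler_wpM2l gap_q; exact: ltW.
have [eta Feta etaP] := IH _ _ (mulr_gt0 A0 q0) dQ.
have Fconv := convolution_mem hw J0 hF (modulate_kernel A0 dg) Bpsi Fpsi.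
exists (fun t => -1 *: (T \o eta) t + (T \o convolution psi (modulate s0 g 0%N)) t).
  by apply: (adm_linear hF); apply: TF.
move=> t; rewrite (modulate_convolution t A0 dg) scaleN1r /=.
rewrite (_ : _ - _ - _ = - T (convolution phi (modulate s0 (Qop b s0 g) 0%N) t - eta t)).
  rewrite rnormN; apply: le_trans (TK _) _.
  apply: le_trans (ler_wpM2l K0 (etaP t)) _.
  by rewrite exprS le_eqVlt; apply/orP; left; apply/eqP; ring.
rewrite linear_sub// opprB opprD opprK.
by rewrite [LHS](AC (2*2) (3*2*(1*4)))/= subrr addr0.
Qed.

End LocalNeumannSeries.

(** The character cancels the modulation, leaving the integral of an even power of [sinc 0 (e t)].
    This function is nonnegative, integrable by the kernel bound, and above 1/2 near 0, where it
    equals 1. *)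
Lemma fourier_modulate_neq0 (R : realType) (s0 : R) (N : nat) (w : R -> R) (e c : R) :
  0 < e -> (forall t, 1 <= w t) -> kernel w c (modulate s0 (sinc_dilate N.*2 e) 0%N) ->
  fourier (modulate s0 (sinc_dilate N.*2 e) 0%N) (character s0) != 0.
Proof.
move=> e0 w1 [cf fk]; set f := modulate _ _ _ in cf fk *.
pose u (t : R) : R := sinc 0 (e * t) ^+ N.*2.
have fE t : character s0 (- t) * f t = (u t)%:C.
  by rewrite /f /modulate /= mulrA character_opp mul1r sinc_dilate0.
have u0 t : 0 <= u t by rewrite /u -muln2 exprM sqr_ge0.
have cu : continuous u.
  move=> t; rewrite /u.
  apply: (@continuous_comp _ _ _ (fun t => sinc 0 (e * t)) (fun x => x ^+ N.*2)).
    apply: (cvg_comp (fun t => e * t) (@sinc R 0)).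
      by apply: cvgM; [exact: cvg_cst|exact: cvg_id].
    exact: is_derive_continuous (sinc_derive 0 (e * t)).
  exact: exprn_continuous.
have uk t : u t <= c * kappa t.
  apply: le_trans (fk t).
  have -> : rnorm (f t) = u t.
    rewrite /f /modulate rnormM rnorm_character mul1r /= sinc_dilate0 rnorm_real.
    exact: ger0_norm (u0 t).
  by rewrite ler_peMr.
have c0 : 0 <= c.
  by rewrite -(pmulr_lge0 _ (kappa_gt0 0)); apply: le_trans (uk 0).
have mu_ : measurable_fun setT u by exact: continuous_measurable_fun.
have uint : (\int[@lebesgue_measure R]_t (u t)%:E <= (c * pi)%:E)%E.
  by apply: integral_kappa_le => // t; rewrite u0 uk.
have upos : (0 < \int[@lebesgue_measure R]_t (u t)%:E)%E.
  have half : (0 : R) < 2^-1 by rewrite invr_gt0.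
  have u00 : u 0 = 1 by rewrite /u mulr0 sinc00 expr1n.
  have /cvgrPdist_lt/(_ _ half) near_0 := cu 0.
  have [d d0 dh] := (nbhs_realP _ _).1 near_0.
  pose I := `]- d, d[%classic : set (measurableTypeR R).
  have md : measurable I by exact: measurable_itv.
  have muI : lebesgue_measure I = (d + d)%:E.
    by rewrite [LHS](lebesgue_measure_itv `]- d, d[)/= lte_fin gtrN// -EFinB opprK.
  have h1 : (0 < \int[@lebesgue_measure R]_(t in I) (cst (2^-1)%:E t))%E.
    by rewrite integral_cst// [X in (_ * X)%E]muI -EFinM lte_fin mulr_gt0// addr_gt0.
  have h2 : (\int[@lebesgue_measure R]_(t in I) (cst (2^-1)%:E t) <=
      \int[@lebesgue_measure R]_(t in I) (u t)%:E)%E.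
    apply: ge0_le_integral => //.
    - by move=> t _; rewrite lee_fin ltW.
    - by apply/measurable_EFinP; apply: measurable_funTS.
    - move=> t; rewrite /I /= in_itv/= -ltr_norml => td; rewrite lee_fin.
      have := dh _ td; rewrite add0r u00 ltr_norml => /andP[_]; lra.
  apply: (lt_le_trans h1); apply: (le_trans h2).
  apply: ge0_subset_integral => //; first exact/measurable_EFinP.
  by move=> t _; rewrite lee_fin.
apply/eqP => /(congr1 (@complex.Re R)); rewrite /fourier /complex_integral /=.
rewrite (_ : (fun t => complex.Re _) = u); last first.
  by apply/funext => t; rewrite fE.
apply/eqP; rewrite gt_eqF//; apply: fine_gt0.
by rewrite upos (le_lt_trans uint)// ltry.
Qed.

Lemma continuous_Re (R : realType) (f : R -> R[i]) :
  continuous (f : R -> R[i]^o) -> continuous (fun t => complex.Re (f t)).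
Proof.
move=> cf t; apply/cvgrPdist_lt => e e0.
have near_t := (@cvg_rnormP R R[i]^o _ _ _ _ _).1 (cf t) e e0.
near=> x; have : rnorm (f t - f x) < e by near: x; exact: near_t.
by apply: le_lt_trans; rewrite -raddfB -lecR -rnormE; exact: normc_ge_Re.
Unshelve. all: by end_near.
Qed.

Lemma kernel_L1w (R : realType) (w : R -> R) (c : R) (f : R -> R[i]) : is_weight w ->
  kernel w c f -> L1w w f.
Proof.
move=> hw kf; have [cf fk] := kf; have c0 := kernel_ge0 hw kf.
have cRe : continuous (fun t => complex.Re (f t)) by exact: continuous_Re.
have cIm : continuous (fun t => complex.Im (f t)).
  (* The imaginary part of [z] is the real part of [- (z * 'i)], which reduces its continuity to
     that of real parts. *)
  have cfi : continuous (fun t => - (f t * 'i%C) : R[i]^o).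
    move=> t; apply: (@cvgN R[i] R[i]^o); apply: (@cvgM R[i]); first exact: cf.
    exact: cvg_cst.
  rewrite (_ : (fun t => complex.Im _) = fun t => complex.Re (- (f t * 'i%C))).
    exact: continuous_Re.
  by apply/funext => t; rewrite -mulNr ReiNIm raddfN opprK.
split; [exact: continuous_measurable_fun|exact: continuous_measurable_fun|].
apply: (@le_lt_trans _ _ (c * pi)%:E); last exact: ltry.
apply: integral_kappa_le => // [|t].
  apply: measurable_funM; last first.
    by apply: continuous_measurable_fun; exact: weight_continuous.
  apply: continuous_measurable_fun => t.
  exact: (@cvg_rnorm R R[i]^o _ _ _ _ _ (cf t)).
by rewrite fk mulr_ge0 ?rnorm_ge0// ltW// weight_gt0.
Qed.

Theorem theorem9p4 (R : realType) (X : completeNormedModType R[i])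
  (J : set R) (hJ : J = [set: R] \/ J = [set t : R | 0 <= t])
  (w : R -> R) (hw : is_weight w) (hgrowth : polynomial_growth w)
  (F : set (R -> X)) (hF : admissible w J F)
  (D : set X) (A : X -> X) (hA : closed_dd_operator D A)
  (hres : resolvent_set D A !=set0)
  (m : nat) (b : 'I_m.+1 -> R[i]) (hb : b ord_max != 0)
  (phi psi : R -> X)
  (hphi : BUCw w [set: R] phi) (hpsi : BUCw w [set: R] psi)
  (Y : set (X -> X)) (hY : closed_op_subspace Y)
  (hYres : forall lambda S, is_resolvent D A lambda S -> Y S)
  (hYF : forall C xi, Y C -> F xi -> F (C \o xi))
  (hdom : dom_B m w phi) (hphiD : forall t, D (phi t))
  (heq : forall t, op_B b phi t = A (phi t) + psi t)
  (hpsiF : F psi) :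
  [set p_B b s | s in sp w F phi] `<=` spectrum D A `&` range (p_B b).
Proof.
move=> _ [s0 sps <-]; split; last by exists s0.
(* Contradiction argument: a value outside the spectrum has a resolvent [T]. *)
move=> [T resT]; have [bT _ Tinv] := resT; have lT := bT.1.
have [K K0 TK] := bounded_op_le bT.
have J0 : J 0 by case: hJ => -> //=.
have w1 := weight_ge1 hw; have w0 := weight_gt0 hw.
have bphi := BUCw_buc hw hphi; have [_ [C C0 phiC] _] := bphi.
(* With [lambda = p_B b s0], [(B - lambda) phi = psi - (lambda - A) phi], and [T] inverts
   [lambda - A] on the domain. *)
have resolvent_eq t : T (op_B b phi t - p_B b s0 *: phi t) = T (psi t) - phi t.
  rewrite -[in RHS](Tinv _ (hphiD t)) -(linear_sub lT); congr T.
  by rewrite heq opprB addrA [psi t + _]addrC.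
have TF xi : F xi -> F (T \o xi) by apply: hYF; exact: hYres resT.
have [N [W wW]] := weight_growth hw hgrowth.
pose p := (N.+2).*2.
pose a := rnorm ('i%C * s0%:C : R[i]).
have a0 : 0 <= a by exact: rnorm_ge0.
(* [d * Q] dominates [q(d)] by [gap_le]; the summand 1 keeps it positive, as the iteration
   requires. *)
pose Q := 1 + \sum_(j < m.+1) rnorm (b j) * (j%:R * (1 + a) ^+ j).
have sum0 : 0 <= \sum_(j < m.+1) rnorm (b j) * (j%:R * (1 + a) ^+ j).
  apply: sumr_ge0 => j _; apply: mulr_ge0; first exact: rnorm_ge0.
  by rewrite mulr_ge0// exprn_ge0// addr_ge0.
have Q0 : 0 < Q by rewrite ltr_pwDl.
have KQ0 : 0 <= K * Q by rewrite mulr_ge0// ltW.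
(* Chosen so that the ratio [K * (d * Q)] of the series is at most 1/2. *)
pose d := (2 * (1 + K * Q))^-1.
have d_gt0 : 0 < d by rewrite invr_gt0 mulr_gt0// ltr_pwDl.
have d1 : d <= 1 by rewrite invf_le1; lra.
have half : K * (d * Q) <= 2^-1.
  rewrite mulrCA /d invfM mulrAC -[leRHS]mulr1 -mulrA ler_wpM2l//.
  by rewrite ler_pdivrMr ?mul1r; lra.
have gap_q : \sum_(j < m.+1) rnorm (b j) * gap s0 d j <= d * Q.
  rewrite /Q mulrDr mulr1 mulr_sumr -[leLHS]add0r; apply: lerD; first exact: ltW.
  apply: ler_sum => j _; rewrite mulrCA; apply: ler_wpM2l; first exact: rnorm_ge0.
  exact: gap_le (ltW d_gt0) d1.
have p0 : 0 < 2 * p%:R :> R by rewrite mulr_gt0// ltr0n.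
(* The [p]-th power of sinc has bandwidth [2 p], so dilation by [e] brings it to [d]. *)
pose e := d / (2 * p%:R).
have e0 : 0 < e by rewrite divr_gt0.
have e1 : e <= 1.
  rewrite ler_pdivrMr// mul1r (le_trans d1)//.
  have : 1 <= p%:R :> R by rewrite ler1n.
  lra.
have [c c0 Hc] := decay_kappa w1 wW e0 e1.
have pE : (N.+1 + N.+3 = p)%N by rewrite /p -addnn !addSn !addnS.
rewrite pE in Hc.
pose H (t : R) : R := (2 / (1 + e * `|t|)) ^+ p.
pose g := @sinc_dilate R p e.
have dom : band_limited H d 1 g.
  split; first exact: sinc_dilate_derivatives.
  move=> k t; rewrite mul1r; apply: le_trans (sinc_dilate_le p k t (ltW e0)) _.
  by rewrite /e divfK ?gt_eqF.
have kg := modulate_kernel hw s0 Hc ltr01 dom.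
have iter := spectral_iteration J0 hw hF hdom.2 bphi hpsi hpsiF lT K0 TK TF
  resolvent_eq (ltW d_gt0) (mulr_gt0 d_gt0 Q0) gap_q Hc C0 phiC.
(* The partial sums lie in [F] within [2^(-n) * M] of the convolution, and [F] is closed. *)
have Ff : F (convolution phi (modulate s0 g 0%N)).
  have bc := convolution_buc hw kg bphi.
  apply: (adm_closed hF (buc_BUCw hw J0 bc)) => r r0.
  pose M := 1 * c * C * pi.
  have M0 : 0 <= M by rewrite !mulr_ge0// pi_ge0.
  have [n Mn] : exists n : nat, (2^-1) ^+ n * M < r.
    exists (Num.truncn (M / r)); rewrite exprVn mulrC ltr_pdivrMr ?exprn_gt0//.
    rewrite mulrC -ltr_pdivrMr//; apply: lt_le_trans (truncnS_gt _) _.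
    by rewrite -natrX ler_nat; exact: ltn_expl.
  have [eta Feta etaP] := iter n 1 g ltr01 dom.
  exists eta => //; apply: (@le_lt_trans _ _ ((2^-1) ^+ n * M)%:E); last by rewrite lte_fin.
  apply/(wnorm_le hw) => t _; apply: le_trans (etaP t) _.
  apply: ler_wpM2r; first exact: ltW.
  apply: ler_wpM2r => //; apply: lerXn2r => //; rewrite nnegrE.
    by rewrite !mulr_ge0// ltW.
  by rewrite invr_ge0.
(* Membership of [s0] in [sp w F phi] now forces the transform of this kernel to vanish at [s0],
   against [fourier_modulate_neq0]. *)
have := sps _ (kernel_L1w hw kg) Ff.
by apply/eqP; exact: fourier_modulate_neq0 e0 w1 kg.
Qed.
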